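(* Let $m,n\in\mathbb N$, $\phi=m/n$, $\Sigma\in\mathbb R^{n\times n}$ an invertible covariance matrix, $\mu_0\in\mathbb R^n$, $\sigma_\xi^2\ge0$. Suppose $1/K\le\phi^{-1}\le K$ and $\|\Sigma\|_{\mathrm{op}}\vee\mathcal H_\Sigma\le K$ for some $K>0$. Then there exists some $C=C(K)>0$ such that for all $\#\in\{\mathsf{pred},\mathsf{est},\mathsf{in}\}$, the derivative formulae $$\partial_\eta\mathscr R^{\#}_{(\Sigma,\mu_0)}(\eta)=\sigma_\xi^2\cdot\mathfrak M^{\#}(\eta)\cdot\big(\eta\cdot\mathsf{SNR}_{\mu_0}-1\big),\qquad\eta\ge0,$$ hold for some measurable functions $\{\mathfrak M^{\#}:\mathbb R_{\ge0}\to[1/C,C]\}$. Consequently, for all $\#\in\{\mathsf{pred},\mathsf{est},\mathsf{in}\}$, $\mathscr R^{\#}_{(\Sigma,\mu_0)}(\cdot)$ attains its global minimum at the same $\eta_\ast\equiv\mathsf{SNR}_{\mu_0}^{-1}\in\Xi_K$, and $$\frac1C\le\frac{\big|\mathscr R^{\#}_{(\Sigma,\mu_0)}(\eta)-\mathscr R^{\#}_{(\Sigma,\mu_0)}(\eta_\ast)\big|}{\|\mu_0\|^2(\eta-\eta_\ast)^2}\le C.$$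
   Context: $\|\cdot\|$ is the Euclidean norm, $\|\cdot\|_{\mathrm{op}}$ the spectral norm, $\mathcal H_\Sigma=\operatorname{tr}(\Sigma^{-1})/n$, $a\vee b=\max\{a,b\}$, $\Xi_K\equiv[\mathbf 1_{\phi^{-1}<1+1/K}K^{-1},K]$. $\mathsf{SNR}_{\mu_0}=\|\mu_0\|^2/\sigma_\xi^2$ is the signal-to-noise ratio; when $\mu_0\ne0$ and $\sigma_\xi^2=0$, $\mathsf{SNR}_{\mu_0}^{-1}$ is interpreted as $0$ (and products $\sigma_\xi^2\,\mathsf{SNR}_{\mu_0}$ are read as $\|\mu_0\|^2$). With $\mathfrak m_\eta\equiv\mathfrak m(-\eta/\phi)$, $\mathfrak m_\eta'\equiv\mathfrak m'(-\eta/\phi)$, define $$\mathscr R^{\mathsf{pred}}_{(\Sigma,\mu_0)}(\eta)=\sigma_\xi^2\Big\{\frac{1}{\mathfrak m_\eta^2}\Big(\phi\,\mathsf{SNR}_{\mu_0}\mathfrak m_\eta-(\eta\,\mathsf{SNR}_{\mu_0}-1)\mathfrak m_\eta'\Big)-1\Big\},$$ $$\mathscr R^{\mathsf{est}}_{(\Sigma,\mu_0)}(\eta)=\sigma_\xi^2\Big\{\mathsf{SNR}_{\mu_0}(1-\phi)+\mathfrak m_\eta+\frac\eta\phi(\eta\,\mathsf{SNR}_{\mu_0}-1)\mathfrak m_\eta'\Big\},$$ $$\mathscr R^{\mathsf{in}}_{(\Sigma,\mu_0)}(\eta)=\sigma_\xi^2\,\frac{\eta^2}{\phi}\Big(\phi\,\mathsf{SNR}_{\mu_0}\mathfrak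 m_\eta-(\eta\,\mathsf{SNR}_{\mu_0}-1)\mathfrak m_\eta'\Big)+\sigma_\xi^2(\phi-2\eta\mathfrak m_\eta).$$ Here $\mathfrak m$ is the Stieltjes transform of the asymptotic eigenvalue density $\rho$ of $G\Sigma G^\top/m$, where $G\in\mathbb R^{m\times n}$ has i.i.d. $\mathcal N(0,1)$ entries: for $z\in\mathbb C$ with $\Im z>0$, $\mathfrak m(z)=\int\frac{\rho(dx)}{x-z}$ is determined uniquely (with $\Im\mathfrak m(z)>0$) by $$z=-\frac1{\mathfrak m(z)}+\frac1\phi\cdot\frac1n\operatorname{tr}\big((I_n+\Sigma\,\mathfrak m(z))^{-1}\Sigma\big),$$ and it is extended to real $z$ outside the support of $\rho$.
   Formalization: As stated, the bounds fail as η→∞ and near η=0. Here 𝔐 and the quotient are ≤C for η≥inf Ξ_K and ≥1/C for η∈Ξ_K; 𝔐>0 for all η≥0; formulae and minimum cover η>0 (η=0 only if φ<1); μ_0≠0 and η_*∈Ξ_K are assumed in the second part, with η≠η_* in the quotient. *)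

(* Defs.v *)
From HB Require Import structures.
From mathcomp Require Export all_boot all_order all_algebra.
From mathcomp Require Export all_classical all_reals all_analysis.
From mathcomp Require Export complex.
From mathcomp Require Import ring lra.
Set Implicit Arguments.
Unset Strict Implicit.
Unset Printing Implicit Defensive.
Import Order.TTheory GRing.Theory Num.Theory.
Import numFieldNormedType.Exports.
Local Open Scope classical_set_scope.
Local Open Scope ring_scope.

(* The norm that the analysis library puts on matrices is the sup norm, so the
   Euclidean norm is defined here. *)
Definition enorm (R : realType) (n : nat) (v : 'cV[R]_n) : R :=
  Num.sqrt (\sum_(i < n) v i 0 ^+ 2).

Definition opnorm (R : realType) (n : nat) (A : 'M[R]_n) : R :=
  sup [set enorm (A *m v) | v in [set v : 'cV[R]_n | enorm v <= 1]].

Definition covariance_mx (R : realType) (n : nat) (A : 'M[R]_n) : Prop :=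
  A^T = A /\ forall v : 'cV[R]_n, 0 <= (v^T *m A *m v) 0 0.

Definition trinv (R : realType) (n : nat) (A : 'M[R]_n) : R :=
  \tr (invmx A) / n%:R.

Definition aspect (R : realType) (m n : nat) : R := m%:R / n%:R.

(* When mu0 != 0 and sigma2 = 0 the convention 0^-1 = 0 gives
   (snr mu0 sigma2)^-1 = 0, as wanted; the value of snr itself is then 0 and
   not the intended +oo, so the risks below never multiply by snr. *)
Definition snr (R : realType) (n : nat) (mu0 : 'cV[R]_n) (sigma2 : R) : R :=
  enorm mu0 ^+ 2 / sigma2.

Definition Xi_lo (R : realType) (phi K : R) : R :=
  if phi^-1 < 1 + K^-1 then K^-1 else 0.

Definition Xi (R : realType) (phi K : R) : set R := `[Xi_lo phi K, K].

Definition cstieltjes (R : realType) (rho : probability (measurableTypeR R) R)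
    (z : R[i]) : R[i] :=
  ((\int[rho]_x complex.Re ((real_complex R x - z)^-1)) +i*
   (\int[rho]_x complex.Im ((real_complex R x - z)^-1)))%C.

(* rho is the limiting eigenvalue distribution of G Sigma G^T / m; the equation
   determines rho uniquely among probability measures.  It has an atom at 0 of
   mass 1 - phi^-1 when phi > 1. *)
Definition asymptotic_eigenvalue_density (R : realType) (n : nat) (phi : R)
    (Sigma : 'M[R]_n) (rho : probability (measurableTypeR R) R) : Prop :=
  forall z : R[i], 0 < complex.Im z ->
    let mz := cstieltjes rho z in
    let SigmaC := map_mx (real_complex R) Sigma in
    0 < complex.Im mz /\
    z = - mz^-1 + real_complex R phi^-1 *
          (\tr (invmx (1%:M + mz *: SigmaC) *m SigmaC) / n%:R).

Definition stieltjes (R : realType) (rho : probability (measurableTypeR R) R)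
    (t : R) : R :=
  \int[rho]_x (x - t)^-1.

Lemma cstieltjes_real (R : realType) (rho : probability (measurableTypeR R) R)
    (t : R) :
  cstieltjes rho (real_complex R t) = real_complex R (stieltjes rho t).
Proof.
rewrite /cstieltjes /stieltjes.
have E (x : R) : (real_complex R x - real_complex R t)^-1
    = real_complex R (x - t)^-1 by rewrite -rmorphB fmorphV.
under eq_Rintegral do rewrite E /=.
under [X in (_ +i* X)%C]eq_Rintegral do rewrite E /=.
by rewrite Rintegral_cst ?mul0r.
Qed.

Definition m_eta (R : realType) (rho : probability (measurableTypeR R) R)
    (phi eta : R) : R := stieltjes rho (- eta / phi).

Definition m_eta' (R : realType) (rho : probability (measurableTypeR R) R)
    (phi eta : R) : R := derive1 (stieltjes rho) (- eta / phi).

Inductive risk_kind := RPred | REst | RIn.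

(* sigma2 is distributed over the braces and sigma2 * snr mu0 sigma2 is replaced
   by b = |mu0|^2, which also covers sigma2 = 0; see riskE. *)
Definition risk (R : realType) (n : nat) (rho : probability (measurableTypeR R) R)
    (phi : R) (mu0 : 'cV[R]_n) (sigma2 : R) (k : risk_kind) (eta : R) : R :=
  let b := enorm mu0 ^+ 2 in
  let m := m_eta rho phi eta in
  let m' := m_eta' rho phi eta in
  match k with
  | RPred => (m ^+ 2)^-1 * (phi * b * m - (eta * b - sigma2) * m') - sigma2
  | REst => b * (1 - phi) + sigma2 * m + eta / phi * (eta * b - sigma2) * m'
  | RIn => eta ^+ 2 / phi * (phi * b * m - (eta * b - sigma2) * m')
          + sigma2 * (phi - 2 * eta * m)
  end.

Lemma riskE (R : realType) (n : nat) (rho : probability (measurableTypeR R) R)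
    (phi : R) (mu0 : 'cV[R]_n) (sigma2 : R) (k : risk_kind) (eta : R) :
  sigma2 != 0 ->
  let s := snr mu0 sigma2 in
  let m := m_eta rho phi eta in
  let m' := m_eta' rho phi eta in
  risk rho phi mu0 sigma2 k eta =
  match k with
  | RPred => sigma2 * ((m ^+ 2)^-1 * (phi * s * m - (eta * s - 1) * m') - 1)
  | REst => sigma2 * (s * (1 - phi) + m + eta / phi * (eta * s - 1) * m')
  | RIn => sigma2 * (eta ^+ 2 / phi) * (phi * s * m - (eta * s - 1) * m')
          + sigma2 * (phi - 2 * eta * m)
  end.
Proof.
move=> s0 /=; rewrite /risk /snr; set b := enorm mu0 ^+ 2.
have Eb : b = sigma2 * (b / sigma2) by rewrite mulrC divfK.
rewrite {1 2 3 4 5 6}Eb; move: (b / sigma2) => s.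
by case: k; ring.
Qed.

(* The eta >= 0 for which - eta / phi lies outside the support of rho: the
   support is contained in [0, +oo[, and contains 0 if and only if phi >= 1. *)
Definition risk_domain (R : realType) (phi : R) : set R :=
  [set eta | 0 <= eta /\ (0 < eta \/ phi < 1)].

(* Main.v *)
Require Import Defs.
From mathcomp Require Import measurable_realfun spectral ring lra.
Set Implicit Arguments.
Unset Strict Implicit.
Unset Printing Implicit Defensive.
Import Order.TTheory GRing.Theory Num.Theory.
Import numFieldNormedType.Exports.
Local Open Scope classical_set_scope.
Local Open Scope ring_scope.

(** Why it is true.  Write [m = m(-s)] with [s = eta / phi], and let [rho] be the
limiting eigenvalue law.  Differentiating the three risks with respect to [eta]
gives [weight * (eta * |mu0|^2 - sigma2)], where, up to the factor [phi^-1], the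
weights are the second derivatives in [z = -s] of [-1/m(z)] for the prediction
risk and of [z m(z)] for the estimation risk, and where the weight of the
in-sample risk is the second derivative of [z^2 m(z)].  So the whole statement
reduces to two-sided bounds on these convexity weights.

In terms of moments [J_k = int (x + s)^-k rho(dx)], the last two weights are
[2/phi int x/(x+s)^3 rho(dx)] and [2 int x^2/(x+s)^3 rho(dx)]: the upper bounds are
pointwise, and the lower bounds follow from Cauchy-Schwarz and the first-order
quantity [J_1 - s J_2 = int x/(x+s)^2 rho(dx)].  For the first weight the defining
equation of [m] yields the closed form [m^2 T'(m) / (phi (1 - T(m))^3)], where
[T(m) = phi^-1 avg ((l m/(1 + l m))^2)] and [l] runs over the spectrum of Sigma.
Everything is then controlled by three elementary facts: [s m <= 1], the
normalisation [1 = phi^-1 avg (l m/(1 + l m)) + s m], and the consequence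
[(1 + K m)(1 - T(m)) >= 1] (lemmas [pred_weight_le] to [in_weight_ge]).

To use these facts at real points, two things have to be extracted from an
equation that is given only in the open upper half plane.

The support of [rho].  Writing [m(a + ib) = u + iv] and taking real and imaginary
parts of the equation gives [u = (P - a) v / b] with [P >= 0]
([density_equations]).  For [a < 0] this forces [v / b <= a^-2] for all [b > 0].
As [v / b] is the integral of [1/((x - a)^2 + b^2)], such a bound makes the mass of
an interval of length [r] at most a constant times [r^2], hence zero, by
bisection ([null_itv]).  So [rho] does not charge the negative axis
([support_ge0]).  When [phi < 1] the same equations bound [m] for [a <= 0] by the
average of [1/l] over [1 - phi]; since [|m(a' + ib) - m(a + ib)|] is at most
[|a' - a|] times an average of the two values of [v / b], the bound survives for
small positive [a], so the support stays away from [0] ([support_gt0]).  This is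
what makes the risks differentiable at [eta = 0].

The limit [b -> 0].  Left of the support the moments of [rho] are smooth, and the
equations pass to the limit ([real_equations]); the one involving the third
moment is obtained by differentiation ([third_equation]).

Finally, [R(eta) - R(eta_star)] equals [|mu0|^2/2] times a value of the weight times
[(eta - eta_star)^2], by Rolle's theorem ([quadratic_gap]), which turns the bounds
on the weights into the quadratic bounds on the risks. *)

(** * Spectrum of a covariance matrix *)

Lemma enorm_ge0 (R : realType) n (v : 'cV[R]_n) : 0 <= enorm v.
Proof. exact: sqrtr_ge0. Qed.

Lemma sqr_enorm (R : realType) n (v : 'cV[R]_n) :
  enorm v ^+ 2 = \sum_(i < n) v i 0 ^+ 2.
Proof. by rewrite sqr_sqrtr// sumr_ge0// => i _; rewrite sqr_ge0. Qed.

Lemma enormZ (R : realType) n (a : R) (v : 'cV[R]_n) :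
  enorm (a *: v) = `|a| * enorm v.
Proof.
rewrite /enorm -[`|a|]sqrtr_sqr -sqrtrM ?sqr_ge0//; congr Num.sqrt.
by rewrite mulr_sumr; apply: eq_bigr => i _; rewrite mxE exprMn.
Qed.

Lemma enorm_gt0 (R : realType) n (v : 'cV[R]_n) : v != 0 -> 0 < enorm v.
Proof.
move=> v0; rewrite lt_def enorm_ge0 andbT; apply: contra v0 => /eqP e0.
have := sqr_enorm v; rewrite e0 expr0n /= => /esym/eqP.
rewrite psumr_eq0 => [/allP h|i _]; last exact: sqr_ge0.
apply/eqP/matrixP => i j; rewrite (ord1 j) mxE.
by apply/eqP; have := h i (mem_index_enum _); rewrite sqrf_eq0.
Qed.

(** Without this the supremum defining [opnorm] would carry no information. *)
Lemma opnorm_has_ubound (R : realType) n (A : 'M[R]_n) :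
  has_ubound [set enorm (A *m v) | v in [set v : 'cV[R]_n | enorm v <= 1]].
Proof.
exists (Num.sqrt (\sum_(i < n) (\sum_(j < n) `|A i j|) ^+ 2)).
move=> _ [v /= v1 <-]; rewrite /enorm ler_sqrt; last first.
  by rewrite sumr_ge0// => i _; rewrite sqr_ge0.
apply: ler_sum => i _; rewrite mxE -[X in X <= _]real_normK ?num_real//.
rewrite ler_sqr ?nnegrE ?normr_ge0 ?sumr_ge0//.
apply: le_trans (ler_norm_sum _ _ _) _; apply: ler_sum => j _.
rewrite normrM ler_piMr ?normr_ge0// (le_trans _ v1)//.
rewrite -[`|_|]sqrtr_sqr ler_sqrt; last first.
  by rewrite sumr_ge0// => k _; rewrite sqr_ge0.
by rewrite (bigD1 j)//= lerDl sumr_ge0// => k _; rewrite sqr_ge0.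
Qed.

Lemma eigenvalue_le_opnorm (R : realType) n (A : 'M[R]_n) (a : R) (v : 'cV[R]_n) :
  v != 0 -> A *m v = a *: v -> a <= opnorm A.
Proof.
move=> v0 Av; have ev := enorm_gt0 v0.
apply: le_trans (ler_norm a) _; apply: sup_ubound; first exact: opnorm_has_ubound.
exists ((enorm v)^-1 *: v) => /=.
  by rewrite enormZ ger0_norm ?invr_ge0 ?enorm_ge0// mulVf// gt_eqF.
rewrite -scalemxAr Av scalerA mulrC -scalerA !enormZ [`|_^-1|]ger0_norm ?invr_ge0 ?enorm_ge0//.
by rewrite mulVf ?mulr1// gt_eqF.
Qed.

Lemma covariance_eigenvalue (R : realType) n (A : 'M[R]_n) (a : R) (v : 'cV[R]_n) :
  covariance_mx A -> A \in unitmx -> v != 0 -> A *m v = a *: v -> 0 < a.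
Proof.
move=> [_ Apos] Au v0 Av; have ev := enorm_gt0 v0; rewrite lt_def; apply/andP; split.
  apply/eqP => a0; move: Av; rewrite a0 scale0r => /(congr1 (mulmx (invmx A))).
  by rewrite mulKmx// mulmx0 => ve; rewrite ve eqxx in v0.
have := Apos v; rewrite -mulmxA Av -scalemxAr mxE mxE.
have -> : \sum_j v^T 0 j * v j 0 = enorm v ^+ 2.
  by rewrite sqr_enorm; apply: eq_bigr => i _; rewrite mxE -expr2.
by rewrite pmulr_lge0// exprn_gt0.
Qed.

(** The bridge from matrices to scalars: afterwards only the eigenvalues of Sigma
matter.  The spectral theorem is applied over the complex numbers; the
eigenvalues are real, hence have real eigenvectors, to which the positivity of
Sigma and the operator norm can be applied. *)
Lemma covariance_spectrum (R : realType) n (Sigma : 'M[R]_n) :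
  covariance_mx Sigma -> Sigma \in unitmx ->
  let SigmaC := map_mx (real_complex R) Sigma in
  exists l : 'I_n -> R,
  [/\ forall i, 0 < l i,
      forall i, l i <= opnorm Sigma,
      \tr (invmx Sigma) = \sum_i (l i)^-1 &
      forall c : R[i], (forall i, 1 + c * real_complex R (l i) != 0) ->
        \tr (invmx (1%:M + c *: SigmaC) *m SigmaC) =
        \sum_i real_complex R (l i) / (1 + c * real_complex R (l i))].
Proof.
move=> cov Su SigmaC.
have Sh : SigmaC \is hermsymmx.
  apply: realsym_hermsym.
    apply/is_hermitianmxP; rewrite expr0 scale1r map_mx_id//.
    by rewrite /SigmaC map_trmx (proj1 cov).
  by apply/mxOverP => i j; rewrite mxE complex_real.
have /hermitian_normalmx/orthomx_spectralP := Sh.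
have := hermitian_spectral_diag_real Sh.
have := spectral_unit SigmaC.
move: (spectral_diag _) (spectralmx _) => D U Uu /mxOverP Dreal SE.
pose l i := complex.Re (D 0 i).
have Dl i : D 0 i = real_complex R (l i) by rewrite /l RRe_real.
have Ur : exists2 v : 'I_n -> 'cV[R]_n, forall i, v i != 0 &
    forall i, Sigma *m v i = l i *: v i.
  suff /choice [v hv] : forall i, exists v : 'cV[R]_n, v != 0 /\ Sigma *m v = l i *: v.
    by exists v => i; have [] := hv i.
  move=> i.
  have ev : eigenvalue SigmaC (real_complex R (l i)).
    apply/eigenvalueP; exists (row i U).
      rewrite SE !mulmxA -row_mul mulmxV// row1 -Dl.
      by rewrite -rowE row_diag_mx -scalemxAl -rowE.
    apply/negP => /eqP/(congr1 (mulmx^~ (invmx U))).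
    rewrite -row_mul mulmxV// mul0mx row1 => /matrixP/(_ 0 i)/eqP.
    by rewrite !mxE !eqxx /= oner_eq0.
  have : eigenvalue Sigma (l i).
    move: ev; rewrite !eigenvalue_root_char /SigmaC -map_char_poly.
    by rewrite fmorph_root.
  move=> /eigenvalueP [v vS v0]; exists v^T; split.
    by apply: contra v0 => /eqP/(congr1 trmx); rewrite trmxK trmx0 => /eqP.
  by rewrite -[in LHS](proj1 cov) -trmx_mul vS linearZ.
have [v v0 Sv] := Ur.
have l0 i : 0 < l i by exact: covariance_eigenvalue cov Su (v0 i) (Sv i).
have trU (E F : 'rV[R[i]]_n) :
    \tr ((invmx U *m diag_mx E *m U) *m (invmx U *m diag_mx F *m U)) =
    \sum_i E 0 i * F 0 i.
  rewrite !mulmxA (mulmxK Uu) -!mulmxA mxtrace_mulC -!mulmxA (mulmxV Uu) mulmx1.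
  by rewrite mulmx_diag mxtrace_diag; apply: eq_bigr => i _; rewrite mxE.
have invU (E : 'rV[R[i]]_n) : (forall i, E 0 i != 0) ->
    invmx (invmx U *m diag_mx E *m U) = invmx U *m diag_mx (\row_i (E 0 i)^-1) *m U.
  move=> E0.
  have e1 : (invmx U *m diag_mx E *m U) *m (invmx U *m diag_mx (\row_i (E 0 i)^-1) *m U) = 1%:M.
    rewrite !mulmxA (mulmxK Uu) -(mulmxA _ (diag_mx E)) mulmx_diag.
    have -> : diag_mx (\row_j (E 0 j * (\row_i (E 0 i)^-1) 0 j)) = 1%:M :> 'M[R[i]]_n.
      by apply/matrixP => i j; rewrite !mxE; case: eqP => [->|//]; rewrite mulfV.
    by rewrite mulmx1 mulVmx.
  have [uE _] := mulmx1_unit e1.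
  by rewrite -[LHS]mulmx1 -e1 mulKmx.
exists l; split => //.
- by move=> i; exact: eigenvalue_le_opnorm (v0 i) (Sv i).
- apply: (@complexI R).
  have -> : real_complex R (\tr (invmx Sigma)) = \tr (invmx SigmaC).
    by rewrite /SigmaC -map_invmx trace_map_mx.
  rewrite SE invU => [|i]; last by rewrite Dl fmorph_eq0 gt_eqF.
  have := trU (\row_i (D 0 i)^-1) (const_mx 1).
  rewrite diag_const_mx mulmx1 mulVmx// mulmx1 => ->.
  rewrite rmorph_sum; apply: eq_bigr => i _.
  by rewrite !mxE mulr1 Dl fmorphV.
- move=> c c0.
  have -> : 1%:M + c *: SigmaC = invmx U *m diag_mx (\row_i (1 + c * D 0 i)) *m U.
    have -> : diag_mx (\row_i (1 + c * D 0 i)) = 1%:M + c *: diag_mx D.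
      by apply/matrixP => i j; rewrite !mxE; case: eqP; rewrite ?mulr1n ?mulr0n ?mulr0 ?addr0.
    by rewrite mulmxDr mulmxDl mulmx1 mulVmx// -scalemxAr -scalemxAl {1}SE.
  rewrite invU => [|i]; last by rewrite mxE Dl.
  by rewrite SE trU; apply: eq_bigr => i _; rewrite !mxE Dl mulrC.
Qed.

(** * Integrals of bounded functions, and the resolvent kernels *)

Lemma measurable_invr (R : realType) :
  measurable_fun (setT : set (measurableTypeR R)) (fun x : R => x^-1).
Proof.
rewrite -(setUv [set (0 : R)]); apply/measurable_funU => //.
  exact: measurableC.
split; first exact: measurable_fun_set1.
apply: open_continuous_measurable_fun; first exact/closed_openC/closed_eq.
by move=> x /set_mem/eqP x0; exact: inv_continuous.
Qed.

Section bounded_measurable.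
Context {R : realType} (rho : probability (measurableTypeR R) R).
Implicit Types (D : set (measurableTypeR R)) (f g h : R -> R).

(** For a probability measure this gives integrability over [D].  Boundedness is
required on [D] only, because resolvents are unbounded near their pole, which
will lie outside the support. *)
Definition bounded_measurable D f :=
  measurable_fun (setT : set (measurableTypeR R)) f /\
  exists B : R, forall x, D x -> `|f x| <= B.

Lemma bounded_measurable_cst D c : bounded_measurable D (fun=> c).
Proof. by split; [exact: measurable_cst|exists `|c|]. Qed.

Lemma bounded_measurableD D f g : bounded_measurable D f ->
  bounded_measurable D g -> bounded_measurable D (fun x => f x + g x).
Proof.
move=> [mf [B fB]] [mg [B' gB]]; split; first exact: measurable_funD.
exists (B + B') => x Dx; apply: le_trans (ler_normD _ _) _.
by rewrite lerD ?fB ?gB.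
Qed.

Lemma bounded_measurableM D f g : bounded_measurable D f ->
  bounded_measurable D g -> bounded_measurable D (fun x => f x * g x).
Proof.
move=> [mf [B fB]] [mg [B' gB]]; split; first exact: measurable_funM.
exists (B * B') => x Dx.
by rewrite normrM ler_pM ?normr_ge0 ?fB ?gB.
Qed.

Lemma bounded_measurableX D f k : bounded_measurable D f ->
  bounded_measurable D (fun x => f x ^+ k).
Proof.
move=> bf; elim: k => [|k ih]; first exact: bounded_measurable_cst.
by under eq_fun do rewrite exprS; exact: bounded_measurableM.
Qed.

Lemma bounded_measurableB D f g : bounded_measurable D f ->
  bounded_measurable D g -> bounded_measurable D (fun x => f x - g x).
Proof.
move=> bf bg; apply: bounded_measurableD => //.
under eq_fun do rewrite -mulN1r.
by apply: bounded_measurableM => //; exact: bounded_measurable_cst.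
Qed.

Lemma bounded_integrable D f : measurable D -> bounded_measurable D f ->
  rho.-integrable D (EFin \o f).
Proof.
move=> mD [mf [B fB]]; apply: measurable_bounded_integrable => //.
- by rewrite (le_lt_trans (probability_le1 _ mD)) ?ltry.
- exact: measurable_funS mf.
- by exists B; split; [exact: num_real|move=> M /ltW BM x Dx; exact: le_trans (fB x Dx) BM].
Qed.

(** Resolvents with a real pole may fail to be integrable near it, so this goes
through almost everywhere equality and not through a splitting of the
integral. *)
Lemma Rintegral_support D f : measurable D -> rho (~` D) = 0%E ->
  measurable_fun (setT : set (measurableTypeR R)) f ->
  \int[rho]_x f x = \int[rho]_(x in D) f x.
Proof.
move=> mD D0 mf; rewrite [RHS]Rintegral_mkcond; congr fine.
apply: ae_eq_integral => //.
- exact/measurable_EFinP.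
- have mfD : measurable_fun D f by exact: measurable_funS mf.
  have mfD' : measurable_fun setT (f \_ D) by exact: (measurable_restrictT f mD).1 mfD.
  exact/measurable_EFinP.
- rewrite /ae_eq; exists (~` D); split => //; first exact: measurableC.
  by move=> x /= /not_implyP[_ h] Dx; apply: h; rewrite /patch mem_set.
Qed.

Variables (D : set (measurableTypeR R)) (mD : measurable D).
Hypothesis rhoD : rho (~` D) = 0%E.

Lemma Rintegral_prob_cst c : \int[rho]_(x in D) c = c.
Proof.
have [mc _] := bounded_measurable_cst D c.
rewrite -(Rintegral_support mD rhoD mc).
rewrite (Rintegral_cst rho (@measurableT _ (measurableTypeR R))).
rewrite -[RHS]mulr1; congr (_ * _).
exact: (congr1 fine (probability_setT rho)).
Qed.

Lemma le_Rintegral_bounded f g : bounded_measurable D f -> bounded_measurable D g ->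
  (forall x, D x -> f x <= g x) ->
  \int[rho]_(x in D) f x <= \int[rho]_(x in D) g x.
Proof. by move=> bf bg; apply: le_Rintegral => //; exact: bounded_integrable. Qed.

Lemma RintegralD_bounded f g : bounded_measurable D f -> bounded_measurable D g ->
  \int[rho]_(x in D) (f x + g x) = \int[rho]_(x in D) f x + \int[rho]_(x in D) g x.
Proof. by move=> bf bg; apply: RintegralD => //; exact: bounded_integrable. Qed.

Lemma RintegralB_bounded f g : bounded_measurable D f -> bounded_measurable D g ->
  \int[rho]_(x in D) (f x - g x) = \int[rho]_(x in D) f x - \int[rho]_(x in D) g x.
Proof. by move=> bf bg; apply: RintegralB => //; exact: bounded_integrable. Qed.

Lemma RintegralZ_bounded f c : bounded_measurable D f ->
  \int[rho]_(x in D) (c * f x) = c * \int[rho]_(x in D) f x.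
Proof. by move=> bf; apply: RintegralZl => //; exact: bounded_integrable. Qed.

Lemma distr_Rintegral_le f g h : bounded_measurable D f -> bounded_measurable D g ->
  bounded_measurable D h -> (forall x, D x -> `|f x - g x| <= h x) ->
  `|\int[rho]_(x in D) f x - \int[rho]_(x in D) g x| <= \int[rho]_(x in D) h x.
Proof.
move=> bf bg bh fgh; have bfg := bounded_measurableB bf bg.
rewrite -RintegralB_bounded//.
apply: le_trans (le_normr_Rintegral mD (bounded_integrable mD bfg)) _.
apply: le_Rintegral_bounded => //.
split; first by case: bfg => mfg _; exact: measurableT_comp.
by case: bfg => _ [B hB]; exists B => x Dx; rewrite normr_id hB.
Qed.

End bounded_measurable.

Section poisson.
Context {R : realType} (rho : probability (measurableTypeR R) R).
Implicit Types a b x : R.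

(** With [z = a + ib] one has [quad a b x = |x - z|^-2], and the two integrals
below are [Re m(z)] and [Im m(z) / b]. *)
Definition quad a b x := ((x - a) ^+ 2 + b ^+ 2)^-1.

Definition re_stieltjes a b := \int[rho]_x ((x - a) * quad a b x).

Definition inv_quad a b := \int[rho]_x quad a b x.

Lemma quad_gt0 a b x : 0 < b -> 0 < quad a b x.
Proof. by move=> b0; rewrite invr_gt0 ltr_wpDl ?sqr_ge0 ?exprn_gt0. Qed.

Lemma quad_le a b x : 0 < b -> quad a b x <= (b ^+ 2)^-1.
Proof.
by move=> b0; rewrite lef_pV2 ?posrE ?lerDr ?sqr_ge0 ?ltr_wpDl ?sqr_ge0 ?exprn_gt0.
Qed.

Lemma measurable_quad a b :
  measurable_fun (setT : set (measurableTypeR R)) (quad a b).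
Proof.
apply: (measurableT_comp (@measurable_invr R)).
by apply: measurable_funD => //; apply: measurable_funX; exact: measurable_funB.
Qed.

Lemma bounded_measurable_quad D a b : 0 < b -> bounded_measurable D (quad a b).
Proof.
move=> b0; split; first exact: measurable_quad.
exists (b ^+ 2)^-1 => x _; rewrite ger0_norm ?quad_le//.
exact/ltW/quad_gt0.
Qed.

Lemma bounded_measurable_quad1 D a b : 0 < b ->
  bounded_measurable D (fun x => (x - a) * quad a b x).
Proof.
move=> b0; split.
  by apply: measurable_funM; [exact: measurable_funB|exact: measurable_quad].
exists b^-1 => x _; have q0 := quad_gt0 a x b0.
rewrite normrM (gtr0_norm q0) /quad ler_pdivrMr; last first.
  by rewrite -invr_gt0.
rewrite ler_pdivlMl//.
have := sqr_ge0 (`|x - a| - b); have := sqr_ge0 (x - a).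
rewrite -[X in X + b ^+ 2]real_normK ?num_real//.
have := normr_ge0 (x - a); nra.
Qed.

Lemma inv_quad_ge0 a b : 0 < b -> 0 <= inv_quad a b.
Proof. by move=> b0; apply: Rintegral_ge0 => x _; exact/ltW/quad_gt0. Qed.

Lemma setCT0 : rho (~` setT) = 0%E.
Proof. by rewrite setCT measure0. Qed.

Lemma inv_quad_le a b : 0 < b -> inv_quad a b <= (b ^+ 2)^-1.
Proof.
move=> b0.
rewrite -[leRHS](Rintegral_prob_cst measurableT setCT0).
apply: le_Rintegral_bounded => //.
- exact: bounded_measurable_quad.
- exact: bounded_measurable_cst.
- by move=> x _; exact: quad_le.
Qed.

Lemma cstieltjesE a b : 0 < b ->
  cstieltjes rho (Complex a b) = Complex (re_stieltjes a b) (b * inv_quad a b).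
Proof.
have resolventE x : (real_complex R x - Complex a b)^-1 =
    Complex ((x - a) * quad a b x) (b * quad a b x).
  have -> : real_complex R x - Complex a b = Complex (x - a) (- b).
    by apply/eqP; rewrite eq_complex /= sub0r !eqxx.
  have -> : (Complex (x - a) (- b))^-1 =
    Complex ((x - a) / ((x - a) ^+ 2 + (- b) ^+ 2))
      (- (- b / ((x - a) ^+ 2 + (- b) ^+ 2))) by [].
  by rewrite sqrrN mulNr opprK.
move=> b0; rewrite /cstieltjes; congr Complex.
  by apply: eq_Rintegral => x _; rewrite resolventE.
rewrite /inv_quad -RintegralZ_bounded//; last exact: bounded_measurable_quad.
by apply: eq_Rintegral => x _; rewrite resolventE.
Qed.

Let bmh D (a a' b h : R) : 0 < b -> 
  bounded_measurable D (fun x => h * (quad a b x + quad a' b x)).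
Proof.
move=> b0; apply: bounded_measurableM; first exact: bounded_measurable_cst.
by apply: bounded_measurableD; exact: bounded_measurable_quad.
Qed.

Let int_bmh (a a' b h : R) : 0 < b -> 
  \int[rho]_x (h * (quad a b x + quad a' b x)) = h * (inv_quad a b + inv_quad a' b).
Proof.
move=> b0; rewrite RintegralZ_bounded//; last first.
  by apply: bounded_measurableD; exact: bounded_measurable_quad.
by rewrite RintegralD_bounded//; exact: bounded_measurable_quad.
Qed.

(** The increment of [1/(x - z)] between [z] and [z'] is at most
[|z' - z| / (|x - z||x - z'|)], hence at most [|z' - z|] times the mean of the two
values of [|x - z|^-2].  The right-hand side thus involves [inv_quad] only, which
the fixed point equation controls. *)
Lemma re_stieltjes_lipschitz a a' b : 0 < b ->
  `|re_stieltjes a' b - re_stieltjes a b| <=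
  `|a' - a| / 2 * (inv_quad a b + inv_quad a' b).
Proof.
move=> b0; rewrite -int_bmh//.
apply: (@distr_Rintegral_le _ rho setT) => //.
- exact: bounded_measurable_quad1.
- exact: bounded_measurable_quad1.
- exact: bmh.
move=> x _; have := quad_gt0 a x b0; have := quad_gt0 a' x b0; rewrite /quad.
rewrite !invr_gt0; set A := _ + _; set A' := _ + _ => A'0 A0.
have -> : (x - a') / A - (x - a) / A' = (a' - a) * ((x - a) * (x - a') - b ^+ 2) / (A * A').
  transitivity (((x - a') * A' - (x - a) * A) / (A * A')).
    by field; rewrite ?gt_eqF//.
  by congr (_ / _); rewrite /A /A'; ring.
have -> : `|a' - a| / 2 * (A'^-1 + A^-1) = `|a' - a| * ((A + A') / 2) / (A * A').
  by field; rewrite ?gt_eqF//.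
have AA0 : 0 < (A * A')^-1 by rewrite invr_gt0 mulr_gt0.
rewrite normrM [`|_^-1|]gtr0_norm// ler_pM2r// normrM ler_wpM2l//.
rewrite /A /A'; move: (x - a) (x - a') => s t.
have := sqr_ge0 (s + t); have := sqr_ge0 (s - t); have := sqr_ge0 b.
rewrite ler_norml => *; apply/andP; split; nra.
Qed.

Lemma im_stieltjes_lipschitz a a' b : 0 < b ->
  `|b * inv_quad a' b - b * inv_quad a b| <=
  `|a' - a| / 2 * (inv_quad a b + inv_quad a' b).
Proof.
move=> b0; rewrite -int_bmh//.
have bq c : bounded_measurable setT (fun x => b * quad c b x).
  apply: bounded_measurableM; first exact: bounded_measurable_cst.
  exact: bounded_measurable_quad.
rewrite -!RintegralZ_bounded//; try exact: bounded_measurable_quad.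
apply: (@distr_Rintegral_le _ rho setT) => //.
  exact: bmh.
move=> x _; have := quad_gt0 a x b0; have := quad_gt0 a' x b0; rewrite /quad.
rewrite !invr_gt0; set A := _ + _; set A' := _ + _ => A'0 A0.
have -> : b / A - b / A' = (a' - a) * (b * ((x - a) + (x - a'))) / (A * A').
  transitivity ((b * A' - b * A) / (A * A')).
    by field; rewrite ?gt_eqF//.
  by congr (_ / _); rewrite /A /A'; ring.
have -> : `|a' - a| / 2 * (A'^-1 + A^-1) = `|a' - a| * ((A + A') / 2) / (A * A').
  by field; rewrite ?gt_eqF//.
have AA0 : 0 < (A * A')^-1 by rewrite invr_gt0 mulr_gt0.
rewrite normrM [`|_^-1|]gtr0_norm// ler_pM2r// normrM ler_wpM2l//.
rewrite /A /A'; move: (x - a) (x - a') => s t.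
have := sqr_ge0 (s + b); have := sqr_ge0 (s - b).
have := sqr_ge0 (t + b); have := sqr_ge0 (t - b).
rewrite ler_norml => *; apply/andP; split; nra.
Qed.

(** The kernel is at least [1/(2 b^2)] on the interval; a bound on [inv_quad] that
is uniform in [b] therefore makes the mass quadratic in the length. *)
Lemma prob_itv_le a b : 0 < b ->
  fine (rho `[a - b, a + b]%classic) <= 2 * b ^+ 2 * inv_quad a b.
Proof.
move=> b0.
have -> : fine (rho `[a - b, a + b]%classic) = \int[rho]_x \1_(`[a - b, a + b]%classic) x.
  by rewrite /Rintegral integral_indic ?setIT.
rewrite -RintegralZ_bounded//; last exact: bounded_measurable_quad.
apply: le_Rintegral_bounded => //.
- split; first exact: measurable_indic.
  by exists 1 => x _; rewrite ger0_norm ?indicE// lern1 leq_b1.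
- apply: bounded_measurableM; first exact: bounded_measurable_cst.
  exact: bounded_measurable_quad.
- move=> x _; rewrite indicE; have q0 := quad_gt0 a x b0.
  case: (boolP (x \in _)) => [/set_mem|_] /=; last by rewrite mulr_ge0 ?mulr_ge0 ?sqr_ge0 ?ltW.
  rewrite in_itv /= => /andP[h1 h2]; rewrite /quad ler_pdivlMr; last first.
    by rewrite -invr_gt0.
  by nra.
Qed.

End poisson.

(** * From kernel bounds to null sets *)

Section null_sets.
Context {R : realType} (rho : probability (measurableTypeR R) R).

(** Halving an interval divides the quadratic bound on the mass of each half by
four, so [k] bisections improve the bound on the whole by [2^k]. *)
Lemma bisect_itv_prob (B : R) (c d : R) (k : nat) : c < d ->
  (forall a y, c <= a <= d -> 0 < y -> inv_quad rho a y <= B) ->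
  (rho `[c, d]%classic <= (B * (d - c) ^+ 2 / 2 ^+ k)%:E)%E.
Proof.
elim: k c d => [|k ih] c d cd hB.
  have mid : c <= (c + d) / 2 <= d by apply/andP; split; lra.
  have y0 : 0 < (d - c) / 2 by lra.
  have := prob_itv_le rho ((c + d) / 2) y0.
  have -> : (c + d) / 2 - (d - c) / 2 = c by field.
  have -> : (c + d) / 2 + (d - c) / 2 = d by field.
  have frho : rho `[c, d]%classic \is a fin_num by exact: fin_num_measure.
  rewrite -[X in (X <= _)%E]fineK// lee_fin => /le_trans; apply; rewrite expr0 divr1.
  have q0 := inv_quad_ge0 rho ((c + d) / 2) y0.
  have := hB _ _ mid y0 => qB.
  have := sqr_ge0 ((d - c) / 2).
  have -> : (d - c) ^+ 2 = 4 * ((d - c) / 2) ^+ 2 by field.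
  move: (((d - c) / 2) ^+ 2) (inv_quad _ _ _) q0 qB => s q; nra.
pose e := (c + d) / 2.
have ce : c < e by rewrite /e; lra.
have ed : e < d by rewrite /e; lra.
have h1 : (rho `[c, e]%classic <= (B * (e - c) ^+ 2 / 2 ^+ k)%:E)%E.
  apply: ih => // a y /andP[ca ae] y0; apply: hB => //.
  by rewrite ca (le_trans ae (ltW ed)).
have h2 : (rho `[e, d]%classic <= (B * (d - e) ^+ 2 / 2 ^+ k)%:E)%E.
  apply: ih => // a y /andP[ea ad] y0; apply: hB => //.
  by rewrite ad (le_trans (ltW ce) ea).
have -> : (B * (d - c) ^+ 2 / 2 ^+ k.+1) =
    B * (e - c) ^+ 2 / 2 ^+ k + B * (d - e) ^+ 2 / 2 ^+ k.
  have : (2 : R) ^+ k != 0 by rewrite expf_neq0.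
  by rewrite /e (exprS 2 k); move: (2 ^+ k) => p p0; field.
rewrite EFinD; apply: le_trans (leeD h1 h2).
have -> : `[c, d]%classic = `[c, e[%classic `|` `[e, d]%classic.
  by rewrite (@itv_bndbnd_setU _ _ (BLeft c) (BLeft e) (BRight d)) ?bnd_simp ?ltW.
apply: le_trans (measureU2 _ _ _) _ => //.
apply: leeD => //; apply: le_measure; rewrite ?inE//.
by apply: subset_itvl; rewrite bnd_simp.
Qed.

Lemma null_itv (B : R) (c d : R) : c < d ->
  (forall a y, c <= a <= d -> 0 < y -> inv_quad rho a y <= B) ->
  rho `[c, d]%classic = 0%E.
Proof.
move=> cd hB; apply/eqP; rewrite -measure_le0 leNgt; apply/negP.
have frho : rho `[c, d]%classic \is a fin_num by exact: fin_num_measure.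
rewrite -[X in (_ < X)%E]fineK// lte_fin; set r := fine _ => r0.
pose X := B * (d - c) ^+ 2.
have Xk k : r * 2 ^+ k <= X.
  have := bisect_itv_prob k cd hB; rewrite -[X in (X <= _)%E]fineK// lee_fin.
  by rewrite ler_pdivlMr// exprn_gt0.
have X0 : 0 <= X / r.
  by rewrite divr_ge0 ?ltW// (lt_le_trans _ (Xk 0%N))// expr0 mulr1.
have := Xk (Num.bound (X / r)); apply/negP; rewrite -ltNge.
rewrite mulrC -ltr_pdivrMr//; apply: lt_trans (archi_boundP X0) _.
by rewrite -natrX ltr_nat ltn_expl.
Qed.

(** The bound may degenerate as [d] approaches [t0]: countably many compact
intervals are enough to exhaust the ray. *)
Lemma null_ray (t0 : R) :
  (forall d, d < t0 -> exists B, forall a y, a <= d -> 0 < y -> inv_quad rho a y <= B) ->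
  rho `]-oo, t0[%classic = 0%E.
Proof.
move=> h.
pose F k := `[t0 - k.+2%:R, t0 - k.+1%:R^-1]%classic : set (measurableTypeR R).
have F0 k : rho (F k) = 0%E.
  have k0 : (0 : R) < k.+1%:R by [].
  have kd : t0 - k.+1%:R^-1 < t0 by rewrite ltrBlDr ltrDl invr_gt0.
  have [B hB] := h _ kd.
  apply: (@null_itv B) => [|a y /andP[_ ad]]; last exact: hB.
  rewrite ltrD2l ltrN2 (@le_lt_trans _ _ 1)// ?invf_le1// ?ler1n ?ltr1n//.
have nF : rho.-negligible (\bigcup_k F k).
  apply: negligible_bigcup => k.
  have mF : measurable (F k) by rewrite /F.
  exact/(negligibleP rho mF)/F0.
apply/(negligibleP rho) => //; apply: negligibleS nF => x /=.
rewrite in_itv /= => xt.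
have y0 : 0 < t0 - x by lra.
pose k := maxn (Num.bound (t0 - x)) (Num.bound (t0 - x)^-1).
exists k => //; rewrite /F /= in_itv /=; apply/andP; split.
  rewrite lerBlDr -lerBlDl; apply: le_trans (ltW (archi_boundP (ltW y0))) _.
  by rewrite ler_nat -addn2; exact: leq_trans (leq_maxl _ _) (leq_addr _ _).
rewrite lerBrDr -lerBrDl -[leRHS]invrK lef_pV2 ?posrE ?invr_gt0//.
have iy0 : 0 <= (t0 - x)^-1 by rewrite invr_ge0 ltW.
apply: le_trans (ltW (archi_boundP iy0)) _.
by rewrite ler_nat; exact: leq_trans (leq_maxr _ _) (leqnSn _).
Qed.

End null_sets.

(** * The fixed point equation in real coordinates *)

Section averages.
Context {R : realType} (n : nat).
Implicit Types f g : 'I_n -> R.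

Definition avg f : R := (\sum_(i < n) f i) / n%:R.

Lemma avgD f g : avg (fun i => f i + g i) = avg f + avg g.
Proof. by rewrite /avg big_split mulrDl. Qed.

Lemma avgZ (c : R) f : avg (fun i => c * f i) = c * avg f.
Proof. by rewrite /avg -mulr_sumr mulrA. Qed.

Hypothesis n0 : (0 < n)%N.

Lemma avg_le f g : (forall i, f i <= g i) -> avg f <= avg g.
Proof.
move=> fg; rewrite /avg ler_pM2r ?invr_gt0 ?ltr0n//.
by apply: ler_sum => i _; exact: fg.
Qed.

Lemma avg_cst (c : R) : avg (fun _ : 'I_n => c) = c.
Proof.
rewrite /avg sumr_const card_ord -[c *+ n]mulr_natr mulfK//.
by rewrite pnatr_eq0 -lt0n.
Qed.

Lemma avg_gt0 f : (forall i, 0 < f i) -> 0 < avg f.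
Proof.
move=> f0; rewrite /avg divr_gt0 ?ltr0n//.
case: n n0 f f0 => // k _ f f0; rewrite big_ord_recl ltr_pwDl//.
by apply: sumr_ge0 => i _; exact: ltW.
Qed.

Lemma avg_ge0 f : (forall i, 0 <= f i) -> 0 <= avg f.
Proof. by move=> f0; rewrite -(avg_cst 0); exact: avg_le. Qed.

End averages.

Section fixed_point.
Context {R : realType} (n : nat) (phi : R) (l : 'I_n -> R).
Hypothesis l0 : forall i, 0 < l i.
Implicit Types a b u v m : R.

Definition sqmod u v i := (1 + u * l i) ^+ 2 + (v * l i) ^+ 2.

(** With [M = u + iv] and [sqmod] the values of [|1 + l M|^2], the numbers
[pmean] and [(u^2 + v^2) * qmean] are the [P] and [T] of the opening comment, there at real argument. *)
Definition pmean u v := phi^-1 * avg (fun i => l i / sqmod u v i).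

Definition qmean u v := phi^-1 * avg (fun i => l i ^+ 2 / sqmod u v i).

Lemma sum_Complex (f g : 'I_n -> R) :
  \sum_(i < n) Complex (f i) (g i) = Complex (\sum_i f i) (\sum_i g i).
Proof. by elim/big_rec3: _ => // i x y z _ ->. Qed.

Lemma sqmod_gt0 u v i : 0 < v -> 0 < sqmod u v i.
Proof. by move=> v0; rewrite ltr_wpDl ?sqr_ge0// exprn_gt0// mulr_gt0. Qed.

Lemma spectral_term u v i : 0 < v ->
  real_complex R (l i) / (1 + Complex u v * real_complex R (l i)) =
  Complex (l i / sqmod u v i + u * (l i ^+ 2 / sqmod u v i))
          (- v * (l i ^+ 2 / sqmod u v i)).
Proof.
move=> v0; have N0 := sqmod_gt0 u i v0.
have -> : 1 + Complex u v * real_complex R (l i) = Complex (1 + u * l i) (v * l i).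
  by apply/eqP; rewrite eq_complex /=; apply/andP; split; apply/eqP; ring.
have -> : (Complex (1 + u * l i) (v * l i))^-1 =
  Complex ((1 + u * l i) / sqmod u v i) (- ((v * l i) / sqmod u v i)) by [].
by apply/eqP; rewrite eq_complex /=; apply/andP; split; apply/eqP; field; rewrite gt_eqF.
Qed.

(** Real and imaginary parts of the equation.  The point of this form is that the
first moment [u] and the density [v / b] become proportional, with a factor
[P - a] of known sign. *)
Lemma fixed_point_real a b u v : 0 < v ->
  Complex a b = - (Complex u v)^-1 + real_complex R phi^-1 *
    ((\sum_i real_complex R (l i) / (1 + Complex u v * real_complex R (l i))) / n%:R) ->
  [/\ 1 - (u ^+ 2 + v ^+ 2) * qmean u v = (pmean u v - a) * u + b * v,
      u * b = (pmean u v - a) * v &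
      b * (u ^+ 2 + v ^+ 2) = v * (1 - (u ^+ 2 + v ^+ 2) * qmean u v)].
Proof.
move=> v0.
under eq_bigr do rewrite spectral_term//.
rewrite sum_Complex.
have -> : (n%:R : R[i]) = real_complex R n%:R by rewrite rmorph_nat.
rewrite -fmorphV.
have -> : (Complex u v)^-1 = Complex (u / (u ^+ 2 + v ^+ 2)) (- (v / (u ^+ 2 + v ^+ 2))) by [].
set r := u ^+ 2 + v ^+ 2.
have r0 : r != 0 by rewrite gt_eqF// ltr_wpDl ?sqr_ge0 ?exprn_gt0.
move/eqP; rewrite eq_complex /= => /andP[/eqP ea /eqP eb].
have {}ea : a = - (u / r) + (pmean u v + u * qmean u v).
  rewrite ea /pmean /qmean big_split -mulr_sumr /avg /=; ring.
have {}eb : b = v / r - v * qmean u v.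
  rewrite eb /qmean -mulr_sumr /avg /=; ring.
rewrite {}ea {}eb; split; [|by field|by field].
have -> : (pmean u v - (- (u / r) + (pmean u v + u * qmean u v))) * u +
  (v / r - v * qmean u v) * v = (u ^+ 2 + v ^+ 2) * (r^-1 - qmean u v) by ring.
by rewrite -/r mulrBr mulfV.
Qed.

End fixed_point.

Definition fixed_point_equations (R : realType) n (phi : R) (l : 'I_n -> R)
    (rho : probability (measurableTypeR R) R) : Prop :=
  forall a b : R, 0 < b ->
  let u := re_stieltjes rho a b in let s := inv_quad rho a b in
  let v := b * s in
  [/\ 0 < s,
      1 - (u ^+ 2 + v ^+ 2) * qmean phi l u v = (pmean phi l u v - a) * u + b * v,
      u = (pmean phi l u v - a) * s &
      u ^+ 2 + v ^+ 2 = s * (1 - (u ^+ 2 + v ^+ 2) * qmean phi l u v)].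

Section density_equations.
Context {R : realType} (n : nat) (phi : R) (Sigma : 'M[R]_n) (l : 'I_n -> R)
  (rho : probability (measurableTypeR R) R).
Hypothesis l0 : forall i, 0 < l i.
Hypothesis trE : forall c : R[i], (forall i, 1 + c * real_complex R (l i) != 0) ->
  \tr (invmx (1%:M + c *: map_mx (real_complex R) Sigma) *m map_mx (real_complex R) Sigma) =
  \sum_i real_complex R (l i) / (1 + c * real_complex R (l i)).
Hypothesis dens : asymptotic_eigenvalue_density phi Sigma rho.

Lemma density_equations : fixed_point_equations phi l rho.
Proof.
move=> a b b0 /=; have := dens (z := Complex a b) b0; rewrite cstieltjesE//=.
set u := re_stieltjes _ _ _; set s := inv_quad _ _ _ => -[v0].
have s0 : 0 < s by rewrite pmulr_rgt0 in v0.
rewrite trE => [|i]; last first.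
  apply/negP => /eqP/(congr1 (@complex.Im R)) /=.
  by move/eqP; rewrite mulr0 add0r add0r gt_eqF// mulr_gt0.
move=> /(fixed_point_real l0 v0)[e1 e2 e3]; split => //.
  apply: (mulIf (lt0r_neq0 b0)); rewrite e2; ring.
apply: (mulfI (lt0r_neq0 b0)); rewrite e3; ring.
Qed.

End density_equations.

(** * The support of the eigenvalue density *)

Section support.
Context {R : realType} (n : nat) (phi : R) (l : 'I_n -> R)
  (rho : probability (measurableTypeR R) R).
Hypothesis n0 : (0 < n)%N.
Hypothesis phi0 : 0 < phi.
Hypothesis l0 : forall i, 0 < l i.
Hypothesis eqs : fixed_point_equations phi l rho.

Lemma pmean_ge0 u v : 0 <= pmean phi l u v.
Proof.
apply: mulr_ge0; first by rewrite invr_ge0 ltW.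
apply: avg_ge0 => // i.
by rewrite divr_ge0 ?addr_ge0 ?sqr_ge0// ltW.
Qed.

Lemma qmean_ge0 u v : 0 <= qmean phi l u v.
Proof.
apply: mulr_ge0; first by rewrite invr_ge0 ltW.
apply: avg_ge0 => // i.
by rewrite divr_ge0 ?addr_ge0 ?sqr_ge0.
Qed.

(** Left of [0] the factor [P - a] is at least [-a], whence [-a s <= u] with
[s = v / b]; as [u^2 <= s], both [u] and [s] are bounded independently of [b]. *)
Lemma support_ge0 : rho `]-oo, 0[%classic = 0%E.
Proof.
apply: null_ray => d d0; exists (d ^+ 2)^-1 => a y ad y0.
have /= [] := eqs a y0; set u := re_stieltjes _ _ _; set s := inv_quad _ _ _ => s0 _ e2 e3.
have P0 := pmean_ge0 u (y * s); have Q0 := qmean_ge0 u (y * s).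
move: (pmean _ _ _ _) (qmean _ _ _ _) P0 Q0 e2 e3 => P Q P0 Q0 e2 e3.
have us : - d * s <= u by rewrite e2; nra.
have u0 : 0 < u by nra.
have us2 : u ^+ 2 <= s.
  have v2 := sqr_ge0 (y * s).
  apply: (@le_trans _ _ (u ^+ 2 + (y * s) ^+ 2)); first by rewrite lerDl.
  by rewrite e3 ler_piMr ?(ltW s0)// lerBlDr lerDl mulr_ge0 ?addr_ge0 ?sqr_ge0.
have ud : - d * u <= 1.
  rewrite -(ler_pM2r u0) mul1r; apply: le_trans us.
  have := @mulr_ge0 _ (- d) (s - u ^+ 2); rewrite oppr_ge0 subr_ge0 => /(_ (ltW d0) us2); nra.
have d2 : 0 < d ^+ 2 by rewrite exprn_even_gt0 //= lt_eqF.
by rewrite -[_^-1]mul1r ler_pdivlMr//; nra.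
Qed.

(** The real part of [avg (1/(1 + l M)) = 1 - phi (1 + z M)], which is where the
hypothesis [phi < 1] will enter. *)
Lemma avg_resolvent a b : 0 < b ->
  let u := re_stieltjes rho a b in let v := b * inv_quad rho a b in
  avg (fun i => (1 + u * l i) / sqmod l u v i) = 1 - phi * (1 + a * u - b * v).
Proof.
move=> b0 /=; have /= [] := eqs a b0; set u := re_stieltjes _ _ _; set s := inv_quad _ _ _.
set v := b * s => s0 e1 _ _; have v0 : 0 < v by rewrite mulr_gt0.
have -> : 1 + a * u - b * v = u * pmean phi l u v + (u ^+ 2 + v ^+ 2) * qmean phi l u v.
  by lra.
transitivity (avg (fun i => 1 + ((- u) * (l i / sqmod l u v i) +
    (- (u ^+ 2 + v ^+ 2)) * (l i ^+ 2 / sqmod l u v i)))).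
  congr avg; apply/funext => i; have := sqmod_gt0 l0 u i v0.
  rewrite /sqmod => N0; field; rewrite gt_eqF//.
rewrite avgD (avg_cst n0) avgD !avgZ /pmean /qmean; field; rewrite gt_eqF//.
Qed.

Section below_one.
Hypothesis phi1 : phi < 1.

Let M0 := avg (fun i => (l i)^-1) / (1 - phi).

Let M00 : 0 < M0.
Proof. by rewrite divr_gt0 ?subr_gt0// avg_gt0 => // i; rewrite invr_gt0. Qed.

(** For [a <= 0] the real part of [z M] is nonpositive, so the average of
[Re 1/(1 + l M)] is at least [1 - phi]; but it is at most the average of [1/l]
divided by [u], or by [v]. *)
Lemma stieltjes_bound_nonpos a b : a <= 0 -> 0 < b ->
  `|re_stieltjes rho a b| <= M0 /\ b * inv_quad rho a b <= M0.
Proof.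
move=> a0 b0; have := avg_resolvent a b0.
have /= [] := eqs a b0; set u := re_stieltjes _ _ _; set s := inv_quad _ _ _.
set v := b * s => s0 e1 e2 _ eA.
have v0 : 0 < v by rewrite mulr_gt0.
have P0 := pmean_ge0 u v.
have u0 : 0 <= u by rewrite e2 mulr_ge0 ?(ltW s0)// subr_ge0 (le_trans a0).
have low : 1 - phi <= avg (fun i => (1 + u * l i) / sqmod l u v i).
  rewrite eA lerD2l lerN2 ler_piMr ?(ltW phi0)//.
  have : a * u <= 0 by rewrite mulr_le0_ge0.
  have : 0 <= b * v by rewrite mulr_ge0 ?(ltW b0) ?(ltW v0).
  by lra.
have phi1' : 0 < 1 - phi by rewrite subr_gt0.
rewrite ger0_norm// /M0 !(ler_pdivlMr _ _ phi1'); split.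
  apply: (@le_trans _ _ (u * avg (fun i => (1 + u * l i) / sqmod l u v i))).
    by rewrite ler_wpM2l.
  rewrite -avgZ; apply: avg_le => // i; have li := l0 i.
  have N0 := sqmod_gt0 l0 u i v0.
  rewrite mulrA ler_pdivrMr// -ler_pdivrMl ?invr_gt0// invrK /sqmod.
  have := sqr_ge0 (v * l i); have : 0 <= u * l i by rewrite mulr_ge0// ltW.
  by nra.
apply: (@le_trans _ _ (v * avg (fun i => (1 + u * l i) / sqmod l u v i))).
  by rewrite ler_wpM2l// ltW.
rewrite -avgZ; apply: avg_le => // i; have li := l0 i.
have N0 := sqmod_gt0 l0 u i v0.
rewrite mulrA ler_pdivrMr// -ler_pdivrMl ?invr_gt0// invrK /sqmod.
have := sqr_ge0 (v * l i - (1 + u * l i)); have := sqr_ge0 (1 + u * l i).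
have := sqr_ge0 (v * l i); nra.
Qed.

(* The bootstrap keeps [|u|] and [v] below [2 M0]; the third [M0] is room for the
   crude estimate of one grid step. *)
Let U := 3 * M0.
Let p := phi^-1 * avg (fun i => l i / ((1 + U * l i) ^+ 2 + (U * l i) ^+ 2)).

Let U0 : 0 < U. Proof. by rewrite mulr_gt0. Qed.

Let p0 : 0 < p.
Proof.
rewrite mulr_gt0 ?invr_gt0// avg_gt0 => // i; rewrite divr_gt0//.
by rewrite ltr_wpDl ?sqr_ge0// exprn_gt0// mulr_gt0.
Qed.

Lemma pmean_lower u v : `|u| <= U -> 0 < v -> v <= U -> p <= pmean phi l u v.
Proof.
move=> uU v0 vU; rewrite ler_pM2l ?invr_gt0//; apply: avg_le => // i; have li := l0 i.
rewrite ler_pM2l// lef_pV2 ?posrE; last 2 first.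
- by rewrite ltr_wpDl ?sqr_ge0// exprn_gt0// mulr_gt0.
- exact: sqmod_gt0.
move: uU; rewrite ler_norml => /andP[uU1 uU2].
have Ul := mulr_gt0 U0 li; have vl := mulr_gt0 v0 li.
have ul1 : u * l i <= U * l i by rewrite ler_pM2r.
have ul2 : - U * l i <= u * l i by rewrite ler_pM2r.
have vUl : v * l i <= U * l i by rewrite ler_pM2r.
rewrite lerD//; last by rewrite ler_sqr ?nnegrE ?(ltW Ul) ?(ltW vl).
by nra.
Qed.

(* [u = (P - a) s] with [P - a >= p / 2] gives [s <= B]. *)
Let B := 2 * U / p.

Let B0 : 0 < B.
Proof. by apply: divr_gt0 => //; apply: mulr_gt0. Qed.

Lemma inv_quad_bound a b : a <= p / 2 -> 0 < b ->
  `|re_stieltjes rho a b| <= U -> b * inv_quad rho a b <= U ->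
  inv_quad rho a b <= B.
Proof.
move=> ap b0; have /= [] := eqs a b0; set u := re_stieltjes _ _ _; set s := inv_quad _ _ _.
set v := b * s => s0 _ e2 _ uU vU.
have pP := pmean_lower uU (mulr_gt0 b0 s0) vU.
move: uU; rewrite ler_norml => /andP[_ uU].
rewrite /B ler_pdivlMr//.
have : (p / 2) * s <= u by rewrite e2 ler_pM2r//; lra.
by lra.
Qed.

(* Chosen so that [B * delta = M0]. *)
Let delta := p / 6.

(** Continuation in [a] at fixed [b], along a grid so fine that even the trivial
Lipschitz constant [b^-2] moves [u] and [v] by at most [M0] in one step.  This
crude control makes [inv_quad_bound] applicable at the next grid point, and then
the increment over the step is at most [B] times its length, uniformly in [b]. *)
Lemma stieltjes_bound_step a b N : 0 <= a -> a <= delta -> 0 < b ->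
  a / N.+1%:R * (b ^+ 2)^-1 <= M0 ->
  forall k, (k <= N.+1)%N ->
  let ak := k%:R * (a / N.+1%:R) in
  `|re_stieltjes rho ak b| <= M0 + B * ak /\ b * inv_quad rho ak b <= M0 + B * ak.
Proof.
move=> a0 ad b0 crude; set h := a / N.+1%:R.
have h0 : 0 <= h by rewrite divr_ge0.
have Bd : B * delta = M0 by rewrite /B /delta /U; field; rewrite gt_eqF.
have kd k : (k <= N.+1)%N -> k%:R * h <= delta.
  move=> kN; apply: le_trans ad; rewrite /h mulrCA ler_piMr//.
  by rewrite ler_pdivrMr// mul1r ler_nat.
elim=> [_|k ih kN] /=.
  by rewrite mul0r mulr0 addr0; exact: stieltjes_bound_nonpos.
have [ihu ihv] := ih (ltnW kN).
set a1 := k%:R * h in ihu ihv *; set a2 := k.+1%:R * h.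
have a12 : a2 - a1 = h by rewrite /a2 /a1 -natr1; ring.
have a1d : a1 <= delta := kd _ (ltnW kN).
have a2d : a2 <= delta := kd _ kN.
have Ba1 : B * a1 <= M0 by rewrite -Bd ler_pM2l.
have dp2 : delta <= p / 2 by rewrite /delta; have := p0; lra.
have q1 : inv_quad rho a1 b <= B.
  apply: inv_quad_bound => //; rewrite /U.
  - exact: le_trans a1d dp2.
  - by apply: le_trans ihu _; have := M00; lra.
  - by apply: le_trans ihv _; have := M00; lra.
have lu := re_stieltjes_lipschitz rho a1 a2 b0.
have lv := im_stieltjes_lipschitz rho a1 a2 b0.
rewrite a12 (ger0_norm h0) in lu lv.
have c1 := inv_quad_le rho a1 b0; have c2 := inv_quad_le rho a2 b0.
(* One step, controlled by the trivial Lipschitz constant. *)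
have crude' : h / 2 * (inv_quad rho a1 b + inv_quad rho a2 b) <= M0.
  apply: le_trans crude; rewrite -/h -mulrA ler_wpM2l//; lra.
have q2 : inv_quad rho a2 b <= B.
  apply: inv_quad_bound => //; rewrite /U.
  - exact: le_trans a2d dp2.
  - have := ler_normD (re_stieltjes rho a2 b - re_stieltjes rho a1 b) (re_stieltjes rho a1 b).
    by rewrite subrK; lra.
  - by move: lv; rewrite ler_norml => /andP[_]; lra.
(* The same step, now that [inv_quad] is bounded by [B] at both ends. *)
have fine_step : h / 2 * (inv_quad rho a1 b + inv_quad rho a2 b) <= B * h.
  by rewrite [B * h]mulrC -mulrA ler_wpM2l//; lra.
have -> : B * a2 = B * a1 + B * h by rewrite -a12; ring.
split.
- have := ler_normD (re_stieltjes rho a2 b - re_stieltjes rho a1 b) (re_stieltjes rho a1 b).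
  by rewrite subrK; lra.
- by move: lv; rewrite ler_norml => /andP[_]; lra.
Qed.

(** The number of grid points depends on [b], the resulting bound does not. *)
Lemma inv_quad_le_delta a b : a <= delta -> 0 < b -> inv_quad rho a b <= B.
Proof.
move=> ad b0.
have dp2 : delta <= p / 2 by rewrite /delta; have := p0; lra.
suff [hu hv] : `|re_stieltjes rho a b| <= U /\ b * inv_quad rho a b <= U.
  exact: inv_quad_bound (le_trans ad dp2) b0 hu hv.
have [a0|/ltW a0] := lerP a 0.
  have [hu hv] := stieltjes_bound_nonpos a0 b0.
  by rewrite /U; have := M00; split; lra.
pose x := a * (b ^+ 2)^-1 / M0.
have x0 : 0 <= x by rewrite !mulr_ge0 ?invr_ge0 ?sqr_ge0 ?(ltW M00).
pose N := Num.bound x.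
have crude : a / N.+1%:R * (b ^+ 2)^-1 <= M0.
  rewrite mulrAC ler_pdivrMr// [leRHS]mulrC -ler_pdivrMr// -/x.
  by apply: le_trans (ltW (archi_boundP x0)) _; rewrite ler_nat.
have := stieltjes_bound_step a0 ad b0 crude (leqnn _).
rewrite /= mulrC divfK// => -[hu hv].
have Bd : B * delta = M0 by rewrite /B /delta /U; field; rewrite gt_eqF.
have : B * a <= M0 by rewrite -Bd ler_pM2l.
by rewrite /U; have := M00; split; lra.
Qed.

Lemma support_gt0 : exists2 t0 : R, 0 < t0 & rho `]-oo, t0[%classic = 0%E.
Proof.
exists delta; first by rewrite divr_gt0.
apply: null_ray => d dd; exists B => a y ad y0; apply: inv_quad_le_delta => //.
exact: le_trans ad (ltW dd).
Qed.

End below_one.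

End support.

(** * Inverse moments left of the support *)

Section real_derivatives.
Context {R : realType}.
Implicit Types (f g : R -> R) (x df dg : R).

Lemma is_deriveR_M f g x df dg : is_derive x (1 : R) f df ->
  is_derive x (1 : R) g dg ->
  is_derive x (1 : R) (fun y => f y * g y) (df * g x + f x * dg).
Proof.
by move=> hf hg; apply: is_derive_eq; rewrite /GRing.scale /= addrC mulrC.
Qed.

Lemma is_deriveR_D f g x df dg : is_derive x (1 : R) f df ->
  is_derive x (1 : R) g dg -> is_derive x (1 : R) (fun y => f y + g y) (df + dg).
Proof. by move=> hf hg; apply: is_deriveD. Qed.

Lemma is_deriveR_B f g x df dg : is_derive x (1 : R) f df ->
  is_derive x (1 : R) g dg -> is_derive x (1 : R) (fun y => f y - g y) (df - dg).
Proof. by move=> hf hg; apply: is_deriveB. Qed.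

Lemma is_deriveR_V f x df : f x != 0 -> is_derive x (1 : R) f df ->
  is_derive x (1 : R) (fun y => (f y)^-1) (- df / f x ^+ 2).
Proof.
move=> fx0 hf; have h := is_deriveV fx0 hf.
by apply: is_derive_eq; rewrite /GRing.scale /= mulNr mulrC mulNr.
Qed.

Lemma is_deriveR_X k f x df : is_derive x (1 : R) f df ->
  is_derive x (1 : R) (fun y => f y ^+ k) (k%:R * f x ^+ k.-1 * df).
Proof. by move=> hf; have := is_deriveX k hf; rewrite exprfctE. Qed.

Lemma is_deriveR_sum n (f : 'I_n -> R -> R) x (df : 'I_n -> R) :
  (forall i, is_derive x (1 : R) (f i) (df i)) ->
  is_derive x (1 : R) (fun y => \sum_i f i y) (\sum_i df i).
Proof.
move=> hf; have -> : (fun y => \sum_i f i y) = \sum_i f i.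
  by apply/funext => y; elim/big_rec2: _ => // i a b _ ->.
apply: is_derive_sum; exact: hf.
Qed.

End real_derivatives.

Section moments.
Context {R : realType} (rho : probability (measurableTypeR R) R) (t0 : R).
Hypothesis null_left : rho `]-oo, t0[%classic = 0%E.

Let D : set (measurableTypeR R) := `[t0, +oo[%classic.

Let mD : measurable D. Proof. by rewrite /D. Qed.

Let D0 : rho (~` D) = 0%E.
Proof. by rewrite /D setCitvr. Qed.

Definition inv_moment k t := \int[rho]_(x in D) (x - t)^-1 ^+ k.

Local Notation J := inv_moment.

Lemma inv_bound t x : t < t0 -> D x -> 0 < (x - t)^-1 <= (t0 - t)^-1.
Proof.
move=> tt0; rewrite /D /= in_itv /= andbT => t0x.
by rewrite invr_gt0 lef_pV2 ?posrE ?subr_gt0 ?lerD2r ?(lt_le_trans tt0) ?t0x.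
Qed.

Lemma bounded_measurable_inv t : t < t0 ->
  bounded_measurable D (fun x => (x - t)^-1).
Proof.
move=> tt0; split.
  apply: (measurableT_comp (@measurable_invr R)); exact: measurable_funB.
exists (t0 - t)^-1 => x /(inv_bound tt0)/andP[x0 xt].
by rewrite gtr0_norm.
Qed.

Lemma bounded_measurable_invX t k : t < t0 ->
  bounded_measurable D (fun x => (x - t)^-1 ^+ k).
Proof. by move=> tt0; exact/bounded_measurableX/bounded_measurable_inv. Qed.

Lemma stieltjes_inv_moment t : t < t0 -> stieltjes rho t = J 1 t.
Proof.
move=> tt0; rewrite /stieltjes (Rintegral_support mD D0)//.
exact: (bounded_measurable_inv tt0).1.
Qed.

Lemma inv_moment_ge0 k t : t < t0 -> 0 <= J k t.
Proof.
move=> tt0; apply: Rintegral_ge0 => x /(inv_bound tt0)/andP[x0 _].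
by rewrite exprn_ge0// ltW.
Qed.

(** Pointwise polynomial inequalities integrate. *)
(** All inequalities between the first three moments that are used later, the
Cauchy-Schwarz ones included, are integrals of a cubic inequality in
[g = 1/(x - t)]. *)
Lemma inv_moment_poly t (c0 c1 c2 c3 : R) : t < t0 ->
  (forall x, t0 <= x -> let g := (x - t)^-1 in 0 < g ->
     0 <= c0 + c1 * g + c2 * g ^+ 2 + c3 * g ^+ 3) ->
  0 <= c0 + c1 * J 1 t + c2 * J 2 t + c3 * J 3 t.
Proof.
move=> tt0 h.
have bc c k : bounded_measurable D (fun x => c * (x - t)^-1 ^+ k).
  apply: bounded_measurableM; first exact: bounded_measurable_cst.
  exact: bounded_measurable_invX.
have -> : c0 + c1 * J 1 t + c2 * J 2 t + c3 * J 3 t =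
    \int[rho]_(x in D) (c0 + c1 * (x - t)^-1 ^+ 1 + c2 * (x - t)^-1 ^+ 2 + c3 * (x - t)^-1 ^+ 3).
  have b0 : bounded_measurable D (fun=> c0) by exact: bounded_measurable_cst.
  have b1 := bounded_measurableD b0 (bc c1 1%N).
  have b2 := bounded_measurableD b1 (bc c2 2%N).
  rewrite (RintegralD_bounded rho mD b2 (bc c3 3%N)).
  rewrite (RintegralD_bounded rho mD b1 (bc c2 2%N)).
  rewrite (RintegralD_bounded rho mD b0 (bc c1 1%N)).
  by rewrite (Rintegral_prob_cst mD D0) !RintegralZ_bounded//; exact: bounded_measurable_invX.
apply: Rintegral_ge0 => x Dx; have /andP[g0 _] := inv_bound tt0 Dx.
by apply: h => //; move: Dx; rewrite /D /= in_itv /= andbT.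
Qed.

(** The error [b^2 J_3] vanishes with [b]: left of the support, the boundary values
of the real part are the first moments. *)
Lemma re_stieltjes_approx t b : t < t0 -> 0 < b ->
  `|re_stieltjes rho t b - J 1 t| <= b ^+ 2 * J 3 t.
Proof.
move=> tt0 b0; have [mq _] := bounded_measurable_quad1 setT t b0.
rewrite /re_stieltjes (Rintegral_support mD D0)// -RintegralZ_bounded//; last first.
  exact: bounded_measurable_invX.
apply: (@distr_Rintegral_le _ rho D) => //.
- exact: bounded_measurable_quad1.
- exact: bounded_measurable_invX.
- apply: bounded_measurableM; first exact: bounded_measurable_cst.
  exact: bounded_measurable_invX.
move=> x /(inv_bound tt0)/andP[g0 _].
have y0 : 0 < x - t by rewrite -invr_gt0.
rewrite /quad expr1; move: (x - t) y0 => y y0 {g0}.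
have N0 : 0 < y ^+ 2 + b ^+ 2 by rewrite addr_gt0// exprn_gt0.
have -> : y / (y ^+ 2 + b ^+ 2) - y^-1 = - (b ^+ 2 * (y^-1 * (y ^+ 2 + b ^+ 2)^-1)).
  by field; rewrite !gt_eqF.
rewrite normrN ger0_norm; last first.
  by apply: mulr_ge0; rewrite ?sqr_ge0//; apply: mulr_ge0; rewrite ?sqr_ge0// invr_ge0 ltW.
rewrite ler_wpM2l ?sqr_ge0// (exprS y^-1 2) ler_wpM2l ?invr_ge0 ?(ltW y0)//.
by rewrite exprVn lef_pV2 ?posrE ?exprn_gt0// lerDl sqr_ge0.
Qed.

Lemma inv_quad_approx t b : t < t0 -> 0 < b ->
  `|inv_quad rho t b - J 2 t| <= b ^+ 2 * J 4 t.
Proof.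
move=> tt0 b0; have mq := measurable_quad t b.
rewrite /inv_quad (Rintegral_support mD D0)// -RintegralZ_bounded//; last first.
  exact: bounded_measurable_invX.
apply: (@distr_Rintegral_le _ rho D) => //.
- exact: bounded_measurable_quad.
- exact: bounded_measurable_invX.
- apply: bounded_measurableM; first exact: bounded_measurable_cst.
  exact: bounded_measurable_invX.
move=> x /(inv_bound tt0)/andP[g0 _].
have y0 : 0 < x - t by rewrite -invr_gt0.
rewrite /quad; move: (x - t) y0 => y y0 {g0}.
have N0 : 0 < y ^+ 2 + b ^+ 2 by rewrite addr_gt0// exprn_gt0.
have -> : (y ^+ 2 + b ^+ 2)^-1 - y^-1 ^+ 2 = - (b ^+ 2 * (y^-1 ^+ 2 * (y ^+ 2 + b ^+ 2)^-1)).
  by field; rewrite !gt_eqF.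
rewrite normrN ger0_norm; last first.
  by apply: mulr_ge0; rewrite ?sqr_ge0//; apply: mulr_ge0; rewrite ?sqr_ge0// invr_ge0 ltW.
rewrite ler_wpM2l ?sqr_ge0// (exprD y^-1 2 2) ler_wpM2l ?sqr_ge0//.
by rewrite exprVn lef_pV2 ?posrE ?exprn_gt0// lerDl sqr_ge0.
Qed.

Lemma is_derive_inv_moment k t : t < t0 ->
  is_derive t (1 : R) (J k.+1) (k.+1%:R * J k.+2 t).
Proof.
move=> tt0; pose w := (t + t0) / 2.
have tw : t < w by rewrite /w; lra.
have wt0 : w < t0 by rewrite /w; lra.
pose f (s x : R) := (x - s)^-1 ^+ k.+1.
have df s x : s < t0 -> D x -> is_derive s (1 : R) (f^~ x) (k.+1%:R * (x - s)^-1 ^+ k.+2).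
  move=> st0 /(inv_bound st0)/andP[xs0 _].
  have x0 : x - s != 0 by rewrite gt_eqF// -invr_gt0.
  have h1 : is_derive s (1 : R) (fun y : R => x - y) (0 - 1).
    exact: is_deriveR_B (is_derive_cst (x : R) s (1 : R)) (is_derive_id s (1 : R)).
  have := is_deriveR_X k.+1 (@is_deriveR_V _ (fun y : R => x - y) s _ x0 h1).
  move/is_derive_eq; apply; rewrite /= sub0r opprK mul1r -mulrA; congr (_ * _).
  by rewrite -exprVn -exprD addn2.
have subt s : `]t - 1, w[%classic s -> s < t0.
  by rewrite /= in_itv /= => /andP[_ sw]; exact: lt_trans sw wt0.
have d1 s x : s < t0 -> D x -> partial1of2 f s x = k.+1%:R * (x - s)^-1 ^+ k.+2.
  by move=> st0 Dx; rewrite partial1of2E; have := df s x st0 Dx; exact: @derive_val.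
have It : `]t - 1, w[%classic t by rewrite /= in_itv /= tw ltrBlDr ltrDl ltr01.
have cvgJ := @cvg_differentiation_under_integral R _ _ rho f D mD t (t - 1) w It
  (fun s Is => bounded_integrable rho mD (bounded_measurable_invX k.+1 (subt s Is)))
  (fun s x Is Dx => @ex_derive _ _ _ _ _ _ _ (df s x (subt s Is) Dx))
  (fun=> k.+1%:R * (t0 - w)^-1 ^+ k.+2) _
  (bounded_integrable rho mD (bounded_measurable_cst D _)).
have G0 (y : R) : 0 <= k.+1%:R * (t0 - w)^-1 ^+ k.+2.
  by rewrite mulr_ge0// exprn_ge0// invr_ge0 subr_ge0 ltW.
have {}cvgJ := cvgJ G0.
have Gub s x : `]t - 1, w[%classic s -> D x ->
    `|partial1of2 f s x| <= k.+1%:R * (t0 - w)^-1 ^+ k.+2.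
  move=> Is Dx; rewrite d1//; last exact: subt.
  have /andP[g0 g1] := inv_bound (subt s Is) Dx.
  have gw : (x - s)^-1 <= (t0 - w)^-1.
    apply: le_trans g1 _; rewrite lef_pV2 ?posrE ?subr_gt0 ?wt0 ?(subt s Is)//.
    by rewrite lerD2l lerN2; move: Is; rewrite /= in_itv /= => /andP[_ /ltW].
  rewrite ger0_norm; last by rewrite mulr_ge0// exprn_ge0// ltW.
  rewrite ler_wpM2l//; apply: lerXn2r => //; rewrite nnegrE ?(ltW g0)//.
  by rewrite invr_ge0 subr_ge0 ltW.
have {}cvgJ := cvgJ Gub.
have E : \int[rho]_(y in D) partial1of2 f t y = k.+1%:R * J k.+2 t.
  rewrite -RintegralZ_bounded//; last exact: bounded_measurable_invX.
  by apply: eq_Rintegral => x /set_mem Dx; rewrite d1.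
rewrite E in cvgJ.
have cvgJ' : h^-1 *: (J k.+1 (h *: 1 + t) - J k.+1 t) @[h --> 0^'] --> k.+1%:R * J k.+2 t.
  by under eq_fun do rewrite [_ *: 1]mulr1.
split; first by apply/cvg_ex; exists (k.+1%:R * J k.+2 t).
exact: cvg_lim cvgJ'.
Qed.

End moments.

(** * The equations on the real line *)

Section limit_equations.
Context {R : realType} (n : nat) (phi : R) (l : 'I_n -> R)
  (rho : probability (measurableTypeR R) R) (t0 : R).
Hypothesis n0 : (0 < n)%N.
Hypothesis phi0 : 0 < phi.
Hypothesis l0 : forall i, 0 < l i.
Hypothesis eqs : fixed_point_equations phi l rho.
Hypothesis null_left : rho `]-oo, t0[%classic = 0%E.

Local Notation J := (inv_moment rho t0).
Local Notation b_ := (@harmonic R).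

Lemma cvg_harmonic_sqr (f : nat -> R) (a c : R) :
  (forall k, `|f k - a| <= b_ k ^+ 2 * c) -> f @ \oo --> a.
Proof.
move=> h.
have h0 : (fun k => b_ k ^+ 2 * c) @ \oo --> (0 : R).
  have -> : (0 : R) = 0 * 0 * c by ring.
  by apply: cvgM; [apply: cvgM; exact: cvg_harmonic|exact: cvg_cst].
have : (fun k => f k - a) @ \oo --> (0 : R).
  apply: norm_cvg0; apply: (squeeze_cvgr _ (cvg_cst 0) h0).
  by apply: nearW => k; rewrite normr_ge0 h.
by move/subr_cvg0.
Qed.

Let sqmod0_gt0 (m : R) i : 0 <= m -> 0 < sqmod l m 0 i.
Proof.
move=> m0; rewrite /sqmod mul0r expr0n /= addr0 exprn_gt0// ltr_pwDl// mulr_ge0//.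
exact: ltW.
Qed.

Let cvg_mean (h : 'I_n -> R) (u v : nat -> R) (m : R) : 0 <= m ->
  u @ \oo --> m -> v @ \oo --> (0 : R) ->
  (fun k => phi^-1 * avg (fun i => h i / sqmod l (u k) (v k) i)) @ \oo -->
    phi^-1 * avg (fun i => h i / sqmod l m 0 i).
Proof.
move=> m0 um v0; apply: cvgM; first exact: cvg_cst.
rewrite /avg; apply: cvgM; last exact: cvg_cst.
have -> : (fun k => \sum_(i < n) h i / sqmod l (u k) (v k) i) =
    \sum_(i < n) (fun k => h i / sqmod l (u k) (v k) i).
  by apply/funext => k; elim/big_rec2: _ => // i x y _ ->.
apply: (@big_ind2 _ _ (fun (f : nat -> R) (a : R) => f @ \oo --> a)).
- exact: cvg_cst.
- by move=> f a g c fa gc; exact: cvgD.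
- move=> i _; apply: cvgM; first exact: cvg_cst.
  apply: cvgV; first by rewrite gt_eqF// sqmod0_gt0.
  apply: cvgD.
    have h1 : (fun k => 1 + u k * l i) @ \oo --> 1 + m * l i.
      by apply: cvgD; [exact: cvg_cst|apply: cvgM => //; exact: cvg_cst].
    exact: cvgM.
  have h2 : (fun k => v k * l i) @ \oo --> 0 * l i.
    by apply: cvgM => //; exact: cvg_cst.
  exact: cvgM.
Qed.

Lemma limit_equations t : t < t0 ->
  let m := J 1 t in let s := J 2 t in
  [/\ 1 - m ^+ 2 * qmean phi l m 0 = (pmean phi l m 0 - t) * m,
      m = (pmean phi l m 0 - t) * s &
      m ^+ 2 = s * (1 - m ^+ 2 * qmean phi l m 0)].
Proof.
move=> tt0 m s.
have b0 k : 0 < b_ k by rewrite /harmonic /= invr_gt0.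
pose u k := re_stieltjes rho t (b_ k).
pose q k := inv_quad rho t (b_ k).
pose v k := b_ k * q k.
have um : u @ \oo --> m.
  by apply: cvg_harmonic_sqr => k; exact: re_stieltjes_approx.
have qs : q @ \oo --> s.
  by apply: cvg_harmonic_sqr => k; exact: inv_quad_approx.
have v0 : v @ \oo --> (0 : R).
  by rewrite -(mul0r s); apply: cvgM => //; exact: cvg_harmonic.
have m0 : 0 <= m by exact: inv_moment_ge0.
have Pm := @cvg_mean l u v m m0 um v0.
have Qm := @cvg_mean (fun i => l i ^+ 2) u v m m0 um v0.
rewrite -/(pmean phi l m 0) in Pm; rewrite -/(qmean phi l m 0) in Qm.
have rm : (fun k => u k ^+ 2 + v k ^+ 2) @ \oo --> m ^+ 2.
  have -> : m ^+ 2 = m * m + 0 * 0 by ring.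
  by apply: cvgD; apply: cvgM.
have Tm : (fun k => 1 - (u k ^+ 2 + v k ^+ 2) * qmean phi l (u k) (v k)) @ \oo -->
    1 - m ^+ 2 * qmean phi l m 0.
  by apply: cvgB; [exact: cvg_cst|exact: cvgM].
have Pt : (fun k => pmean phi l (u k) (v k) - t) @ \oo --> pmean phi l m 0 - t.
  by apply: cvgB => //; exact: cvg_cst.
have lim_eq (f g : nat -> R) (a c : R) : (forall k, f k = g k) ->
    f @ \oo --> a -> g @ \oo --> c -> a = c.
  by move=> /funext -> ga gc; exact: (cvg_unique _ ga gc).
split.
- apply: (lim_eq _ (fun k => (pmean phi l (u k) (v k) - t) * u k + b_ k * v k) _ _ _ Tm).
    by move=> k; have [] := eqs t (b0 k).
  rewrite -[X in _ --> X]addr0 -[X in _ + X](mul0r 0).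
  by apply: cvgD; apply: cvgM => //; exact: cvg_harmonic.
- apply: (lim_eq _ (fun k => (pmean phi l (u k) (v k) - t) * q k) _ _ _ um).
    by move=> k; have [] := eqs t (b0 k).
  exact: cvgM.
- apply: (lim_eq _ (fun k => q k * (1 - (u k ^+ 2 + v k ^+ 2) * qmean phi l (u k) (v k))) _ _ _ rm).
    by move=> k; have [] := eqs t (b0 k).
  exact: cvgM.
Qed.

(** [pavg m] and [tavg m] are [P] and [T] at real argument; [tavg'] is [dT/dm]. *)
Definition pavg m := phi^-1 * avg (fun i => l i / (1 + m * l i) ^+ 2).
Definition tavg m := phi^-1 * avg (fun i => (m * l i / (1 + m * l i)) ^+ 2).
Definition tavg' m := phi^-1 * avg (fun i => 2 * m * l i ^+ 2 / (1 + m * l i) ^+ 3).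

(** Positivity of [J 1 t] comes for free: if it vanished, so would [T], and the
first equation would read [1 = 0]. *)
Lemma real_equations t : t < t0 ->
  [/\ 0 < J 1 t, 1 - tavg (J 1 t) = (pavg (J 1 t) - t) * J 1 t,
      J 1 t = (pavg (J 1 t) - t) * J 2 t &
      J 1 t ^+ 2 = J 2 t * (1 - tavg (J 1 t))].
Proof.
move=> tt0; have /= [] := limit_equations tt0.
have m0 : 0 <= J 1 t by exact: inv_moment_ge0.
have -> : J 1 t ^+ 2 * qmean phi l (J 1 t) 0 = tavg (J 1 t).
  rewrite /qmean mulrCA -avgZ /tavg; congr (_ * avg _); apply/funext => i.
  by rewrite /sqmod mul0r expr0n /= addr0 expr_div_n exprMn mulrA.
have -> : pmean phi l (J 1 t) 0 = pavg (J 1 t).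
  rewrite /pmean /pavg; congr (_ * avg _); apply/funext => i.
  by rewrite /sqmod mul0r expr0n /= addr0.
move=> e1 e2 e3; split => //; rewrite lt_neqAle m0 andbT; apply/eqP => mE.
move: e1; rewrite -mE mulr0 /tavg.
have -> : (fun i : 'I_n => (0 * l i / (1 + 0 * l i)) ^+ 2) = (fun i => 0).
  by apply/funext => i; rewrite mul0r mul0r expr0n.
by rewrite (avg_cst n0) mulr0 subr0 => /eqP; rewrite oner_eq0.
Qed.

Lemma is_derive_tavg t : t < t0 ->
  is_derive t (1 : R) (fun x => tavg (J 1 x)) (tavg' (J 1 t) * J 2 t).
Proof.
move=> tt0; have [m0 _ _ _] := real_equations tt0.
have dJ := is_derive_inv_moment rho 0 tt0; rewrite mul1r in dJ.
have di i : is_derive t (1 : R) (fun x => (J 1 x * l i / (1 + J 1 x * l i)) ^+ 2)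
    (2 * J 1 t * l i ^+ 2 / (1 + J 1 t * l i) ^+ 3 * J 2 t).
  have dm := is_deriveR_M dJ (is_derive_cst (l i) t (1 : R)).
  have d1 := is_deriveR_D (is_derive_cst (1 : R) t (1 : R)) dm.
  have h0 : 1 + J 1 t * l i != 0.
    by rewrite gt_eqF// addr_gt0// mulr_gt0.
  have dv := @is_deriveR_V _ (fun x => 1 + J 1 x * l i) t _ h0 d1.
  have := is_deriveR_X 2 (is_deriveR_M dm dv).
  by move/is_derive_eq; apply; rewrite /cst /=; field.
have ds := is_deriveR_sum di.
have := is_deriveR_M (is_derive_cst phi^-1 t (1 : R))
  (is_deriveR_M ds (is_derive_cst (n%:R^-1 : R) t (1 : R))).
move/is_derive_eq; apply; rewrite /cst /= mulr0 addr0 mul0r add0r -mulr_suml /tavg' /avg.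
ring.
Qed.

(** Derivative of the identity [J_1^2 = J_2 (1 - T(J_1))], using [J_1' = J_2] and
[J_2' = 2 J_3]. *)
Lemma third_equation t : t < t0 ->
  2 * J 3 t * (1 - tavg (J 1 t)) =
  J 2 t ^+ 2 * tavg' (J 1 t) + 2 * J 1 t * J 2 t.
Proof.
move=> tt0.
have dJ := is_derive_inv_moment rho 0 tt0; rewrite mul1r in dJ.
have dJ2 := is_derive_inv_moment rho 1 tt0.
have dT := is_derive_tavg tt0.
have dL := is_deriveR_M dJ2 (is_deriveR_B (is_derive_cst (1 : R) t (1 : R)) dT).
have dR := is_deriveR_X 2 dJ.
have dR' : is_derive t (1 : R) (fun x => J 1 x ^+ 2)
    (2 * J 3 t * (cst 1 t - tavg (J 1 t)) + J 2 t * (0 - tavg' (J 1 t) * J 2 t)).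
  apply: near_eq_is_derive dL.
  have lt0 : \forall x \near t, x < t0 by exact: lt_nbhsl.
  by apply: filterS lt0 => x /real_equations[_ _ _ ->].
have := @derive_val _ _ _ _ _ _ _ dR; rewrite (@derive_val _ _ _ _ _ _ _ dR') /cst /=.
rewrite expr1 => h; lra.
Qed.

End limit_equations.

(** * Bounds on the weights *)

(** From here on a single real point is fixed, and the moments are just numbers
subject to the equations and inequalities established so far. *)
Section bounds.
Context {R : realType} (n : nat) (phi : R) (l : 'I_n -> R) (s m J2 J3 : R).
Hypothesis n0 : (0 < n)%N.
Hypothesis phi0 : 0 < phi.
Hypothesis l0 : forall i, 0 < l i.
Hypothesis s0 : 0 <= s.
Hypothesis m0 : 0 < m.
Hypothesis J20 : 0 <= J2.
Hypothesis J30 : 0 <= J3.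
Hypothesis eq1 : 1 - tavg phi l m = (pavg phi l m + s) * m.
Hypothesis eq2 : m = (pavg phi l m + s) * J2.
Hypothesis eq3 : m ^+ 2 = J2 * (1 - tavg phi l m).
Hypothesis eq4 : 2 * J3 * (1 - tavg phi l m) = J2 ^+ 2 * tavg' phi l m + 2 * m * J2.
Hypothesis cs_est : forall c, 2 * c * (m - s * J2) - c ^+ 2 * (1 - s * m) <= J2 - s * J3.
Hypothesis cs_in : forall c, 2 * c * (m - s * J2) - c ^+ 2 * m <=
  m - 2 * s * J2 + s ^+ 2 * J3.
Hypothesis in_le : m - 2 * s * J2 + s ^+ 2 * J3 <= m.

Definition pred_weight := (2 * m * J3 - 2 * J2 ^+ 2) / (phi * m ^+ 3).
Definition est_weight := 2 / phi * (J2 - s * J3).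
Definition in_weight := 2 * (m - 2 * s * J2 + s ^+ 2 * J3).

Let T := tavg phi l m.
Let P := pavg phi l m.
Let W := phi^-1 * avg (fun i => m * l i / (1 + m * l i)).

Let ml i : 0 < m * l i. Proof. exact: mulr_gt0. Qed.

Let iphi0 : 0 < phi^-1. Proof. by rewrite invr_gt0. Qed.

Let P0 : 0 < P.
Proof.
apply: mulr_gt0 => //; apply: avg_gt0 => // i.
by apply: divr_gt0 => //; rewrite exprn_gt0// addr_gt0.
Qed.

Let T0 : 0 <= T.
Proof. by apply: mulr_ge0; [exact: ltW|apply: avg_ge0 => // i; exact: sqr_ge0]. Qed.

Let T1 : 0 < 1 - T.
Proof. by rewrite /T eq1 mulr_gt0// ltr_wpDr. Qed.

Let J2E : J2 = m ^+ 2 / (1 - T).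
Proof. by rewrite eq3 mulfK// gt_eqF. Qed.

Let J2m : m ^+ 2 <= J2.
Proof. by rewrite eq3 ler_piMr// -/T lerBlDr lerDl. Qed.

Let TP : T + P * m = W.
Proof.
rewrite /T /P /W /tavg /pavg -mulrA -mulrDr [avg _ * m]mulrC -avgZ -avgD.
congr (_ * avg _); apply/funext => i.
by field; rewrite gt_eqF// addr_gt0.
Qed.

(* The equation [z = -1/m + phi^-1 avg (l/(1 + l m))] multiplied by [m]. *)
Let mass : 1 = W + s * m.
Proof. by rewrite -TP; move: eq1; rewrite -/T -/P; lra. Qed.

Lemma sm_le1 : s * m <= 1.
Proof.
rewrite [X in _ <= X]mass lerDr; apply: mulr_ge0; first exact: ltW.
by apply: avg_ge0 => // i; rewrite divr_ge0 ?addr_ge0 ?(ltW (ml i)).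
Qed.

(* Eliminating [J2] and [J3] removes the cancellation in [m J3 - J2^2], which
   is nonnegative by Cauchy-Schwarz but not visibly bounded below. *)
Let predE : pred_weight = phi^-1 * (m ^+ 2 * tavg' phi l m) / (1 - T) ^+ 3.
Proof.
have T1' : 1 - T != 0 by rewrite gt_eqF.
have J3E : J3 = (J2 ^+ 2 * tavg' phi l m + 2 * m * J2) / (2 * (1 - T)).
  by rewrite -eq4 -/T; field.
rewrite /pred_weight J3E J2E; field.
by rewrite T1' !gt_eqF.
Qed.

Let m2T' : m ^+ 2 * tavg' phi l m =
  2 * phi^-1 * avg (fun i => m ^+ 3 * l i ^+ 2 / (1 + m * l i) ^+ 3).
Proof.
rewrite /tavg' mulrCA -avgZ [RHS]mulrAC [RHS]mulrC -[X in _ = _ * X]avgZ.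
congr (_ * avg _).
by apply/funext => i; field; rewrite gt_eqF// addr_gt0.
Qed.

(* [m - s J2] is the integral of [x/(x+s)^2]. *)
Let A2E : m - s * J2 = P * J2.
Proof. by rewrite [X in X - _]eq2 -/P; ring. Qed.

Let A2gt0 : 0 < m - s * J2.
Proof. by rewrite A2E mulr_gt0// (lt_le_trans _ J2m)// exprn_gt0. Qed.

(* Optimal choice of [c] in [cs_est] up to the factor [1 - s m <= 1]. *)
Let A3_ge : (m - s * J2) ^+ 2 <= J2 - s * J3.
Proof.
apply: le_trans (cs_est (m - s * J2)).
have := sqr_ge0 (m - s * J2); have := mulr_ge0 s0 (ltW m0).
by move: (m - s * J2) (s * m) => a x; nra.
Qed.

Let B3_ge : (m - s * J2) ^+ 2 / m <= m - 2 * s * J2 + s ^+ 2 * J3.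
Proof.
apply: le_trans (cs_in ((m - s * J2) / m)).
rewrite le_eqVlt; apply/orP; left; apply/eqP; field; rewrite gt_eqF//.
Qed.

Lemma pred_weight_gt0 : 0 < pred_weight.
Proof.
rewrite predE m2T'; apply: divr_gt0; last exact: exprn_gt0.
do 2 apply: mulr_gt0 => //; first exact: mulr_gt0.
apply: avg_gt0 => // i; apply: divr_gt0; last by rewrite exprn_gt0// addr_gt0.
by rewrite mulr_gt0// exprn_gt0.
Qed.

Lemma est_weight_gt0 : 0 < est_weight.
Proof.
rewrite /est_weight mulr_gt0 ?divr_gt0//; apply: lt_le_trans A3_ge.
by rewrite exprn_gt0.
Qed.

Lemma in_weight_gt0 : 0 < in_weight.
Proof.
rewrite /in_weight mulr_gt0//; apply: lt_le_trans B3_ge.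
by rewrite divr_gt0 ?exprn_gt0.
Qed.

Section uniform.
Variable K : R.
Hypothesis K0 : 0 < K.
Hypothesis lK : forall i, l i <= K.
Hypothesis ilK : avg (fun i => (l i)^-1) <= K.
Hypothesis phiK : K^-1 <= phi^-1 <= K.

Lemma stieltjes_le_far : K ^- 2 <= s -> m <= K * (K + 1).
Proof.
move=> sK; have := sm_le1 => sm1.
have : K ^- 2 * m <= 1 by apply: le_trans sm1; rewrite ler_pM2r.
rewrite ler_pdivrMl ?exprn_gt0// mulr1 => h; apply: le_trans h _.
by have := K0; nra.
Qed.

(** Here [s] may vanish.  The total mass gives [avg (l m/(1 + l m)) <= phi < 1],
which prevents [l m] from being large for most [l]: precisely,
[1 - phi <= avg (1/(1 + l m)) <= avg (1/l) / m]. *)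
Lemma stieltjes_le_overparam : 1 + K^-1 <= phi^-1 -> m <= K * (K + 1).
Proof.
move=> ph.
have phK : phi * (K + 1) <= K.
  have -> : phi * (K + 1) = phi * K * (1 + K^-1) by field; rewrite gt_eqF.
  have KE : phi * K * phi^-1 = K by field; rewrite gt_eqF.
  by rewrite -[X in _ <= X]KE ler_pM2l// mulr_gt0.
have W1 : W <= 1 by rewrite [X in _ <= X]mass lerDl mulr_ge0// ltW.
have W1' : avg (fun i => m * l i / (1 + m * l i)) <= phi.
  by move: W1; rewrite /W ler_pdivrMl// mulr1.
have h1 : 1 - phi <= avg (fun i => m^-1 * (l i)^-1).
  have -> : 1 - phi = avg (fun _ : 'I_n => 1 : R) - phi by rewrite avg_cst.
  rewrite lerBlDr; apply: (@le_trans _ _ (avg (fun i => m^-1 * (l i)^-1 + m * l i / (1 + m * l i)))).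
    apply: avg_le => // i; have := ml i; have := l0 i; move: m0 => hm hl hml.
    have e : m^-1 * (l i)^-1 + m * l i / (1 + m * l i) - 1 = (m * l i * (1 + m * l i))^-1.
      by field; rewrite !gt_eqF// addr_gt0.
    by rewrite -subr_ge0 e invr_ge0 mulr_ge0 ?addr_ge0 ?ltW.
  by rewrite avgD lerD2l.
rewrite avgZ in h1.
have h2 : m * (1 - phi) <= K.
  apply: le_trans ilK; rewrite -ler_pdivlMl//.
have : m * (1 - phi) * (K + 1) <= K * (K + 1) by rewrite ler_pM2r// addr_gt0.
apply: le_trans; rewrite -mulrA ler_peMr ?(ltW m0)//.
by move: phK; lra.
Qed.

Variable M0 : R.
Hypothesis mM0 : m <= M0.

Let d := 1 + K * M0.

Let M00 : 0 < M0. Proof. exact: lt_le_trans mM0. Qed.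

Let d0 : 0 < d. Proof. by rewrite addr_gt0// mulr_gt0. Qed.

Let mld i : 1 + m * l i <= d.
Proof. by rewrite lerD2l mulrC ler_pM// ltW. Qed.

(* [1 - T = P m + s m], while [1 = W + s m] and [W <= (1 + K m) P m]
   termwise. *)
Let T1d : 1 <= d * (1 - T).
Proof.
rewrite /T eq1 -/P.
apply: (@le_trans _ _ (W + s * m)); first by rewrite -mass.
rewrite [(P + s) * m]mulrDl [d * (_ + _)]mulrDr lerD//.
  rewrite /W /P /pavg; set A := avg (fun i => l i / _).
  have -> : d * (phi^-1 * A * m) = phi^-1 * (d * (m * A)) by ring.
  rewrite (ler_pM2l iphi0) /A -[m * avg _]avgZ -[d * avg _]avgZ.
  apply: avg_le => // i; have := ml i; have := mld i => h hml.
  have h1 : 0 < 1 + m * l i by rewrite addr_gt0.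
  rewrite ler_pdivrMr//.
  have -> : d * (m * (l i / (1 + m * l i) ^+ 2)) * (1 + m * l i) = d / (1 + m * l i) * (m * l i).
    by field; rewrite gt_eqF.
  by rewrite ler_peMl ?(ltW hml)// ler_pdivlMr// mul1r.
by rewrite ler_peMl ?mulr_ge0 ?(ltW m0)// lerDl mulr_ge0 ?ltW.
Qed.

Let iT : (1 - T)^-1 <= d.
Proof. by rewrite -[_^-1]mul1r ler_pdivrMr. Qed.

Let J2_le : J2 <= M0 ^+ 2 * d.
Proof.
rewrite J2E ler_pM// ?sqr_ge0 ?invr_ge0 ?(ltW T1)//.
by apply: lerXn2r => //; rewrite nnegrE ltW.
Qed.

Lemma pred_weight_le : pred_weight <= 2 * K ^+ 2 * M0 * d ^+ 3.
Proof.
have /andP[_ pK] := phiK.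
rewrite predE m2T' -exprVn.
have h : avg (fun i => m ^+ 3 * l i ^+ 2 / (1 + m * l i) ^+ 3) <= M0.
  rewrite -(avg_cst n0 M0); apply: avg_le => // i; have := ml i => hml.
  apply: le_trans mM0; rewrite ler_pdivrMr ?exprn_gt0 ?addr_gt0//.
  have -> : m ^+ 3 * l i ^+ 2 = m * (m * l i) ^+ 2 by ring.
  rewrite ler_pM2l//; move: (m * l i) hml => x hx; rewrite !exprS expr0; nra.
have h0 : 0 <= avg (fun i => m ^+ 3 * l i ^+ 2 / (1 + m * l i) ^+ 3).
  by apply: avg_ge0 => // i; rewrite divr_ge0 ?mulr_ge0 ?exprn_ge0 ?addr_ge0 ?(ltW (ml i)) ?(ltW m0) ?(ltW (l0 i)).
have -> : phi^-1 * (2 * phi^-1 * avg (fun i => m ^+ 3 * l i ^+ 2 / (1 + m * l i) ^+ 3)) =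
  2 * phi^-1 ^+ 2 * avg (fun i => m ^+ 3 * l i ^+ 2 / (1 + m * l i) ^+ 3) by ring.
apply: ler_pM.
- by apply: mulr_ge0 => //; apply: mulr_ge0 => //; exact: sqr_ge0.
- by rewrite exprn_ge0// invr_ge0 ltW.
- apply: ler_pM => //; first by apply: mulr_ge0 => //; exact: sqr_ge0.
  by rewrite ler_pM2l// ler_sqr ?nnegrE ?(ltW iphi0) ?(ltW K0).
- by apply: lerXn2r => //; rewrite nnegrE ?invr_ge0 ltW.
Qed.

Lemma est_weight_le : est_weight <= 2 * K * (M0 ^+ 2 * d).
Proof.
have /andP[_ pK] := phiK.
apply: ler_pM.
- by rewrite divr_ge0// ltW.
- exact: le_trans (sqr_ge0 _) A3_ge.
- by rewrite ler_pM2l.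
- by apply: le_trans J2_le; rewrite lerBlDr lerDl mulr_ge0.
Qed.

Lemma in_weight_le : in_weight <= 2 * M0.
Proof. by rewrite /in_weight ler_pM2l//; exact: le_trans in_le mM0. Qed.

Hypothesis sK : s <= K ^+ 2.

Let m_ge : (2 * K ^+ 2)^-1 <= m.
Proof.
have /andP[_ pK] := phiK.
rewrite -[_^-1]mul1r ler_pdivrMr ?mulr_gt0 ?exprn_gt0//.
rewrite [X in X <= _]mass.
have -> : m * (2 * K ^+ 2) = K * (m * K) + K ^+ 2 * m by ring.
rewrite lerD// ?ler_pM2r//; apply: ler_pM => //; rewrite ?(ltW iphi0)//.
  by apply: avg_ge0 => // i; rewrite divr_ge0 ?addr_ge0 ?(ltW (ml i)).
rewrite -(avg_cst n0 (m * K)); apply: avg_le => // i; have := ml i => hml.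
rewrite ler_pdivrMr ?addr_gt0//.
have : m * l i <= m * K by rewrite ler_pM2l.
move: (m * l i) (m * K) hml => x y hx; nra.
Qed.

(* Tangent line of [1/y] at [y = K] for [y = 1/l]: Jensen's inequality. *)
Let avg_l : K^-1 <= avg l.
Proof.
have -> : K^-1 = 2 * K^-1 - K^-1 ^+ 2 * K by field; rewrite gt_eqF.
apply: (@le_trans _ _ (2 * K^-1 - K^-1 ^+ 2 * avg (fun i => (l i)^-1))).
  by rewrite lerD2l lerN2 ler_wpM2l ?sqr_ge0.
rewrite lerBlDr -avgZ -avgD -(avg_cst n0 (2 * K^-1)); apply: avg_le => // i.
rewrite -subr_ge0; have li := l0 i.
have -> : l i + K^-1 ^+ 2 / l i - 2 / K = (l i - K^-1) ^+ 2 / l i.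
  by field; rewrite !gt_eqF.
by rewrite divr_ge0 ?sqr_ge0 ?ltW.
Qed.

(* Likewise for [1/y^2]. *)
Let avg_l2 : K^-1 ^+ 2 <= avg (fun i => l i ^+ 2).
Proof.
have -> : K^-1 ^+ 2 = 3 * K^-1 ^+ 2 - 2 * K^-1 ^+ 3 * K by field; rewrite gt_eqF.
have iK : 0 < K^-1 by rewrite invr_gt0.
apply: (@le_trans _ _ (3 * K^-1 ^+ 2 - 2 * K^-1 ^+ 3 * avg (fun i => (l i)^-1))).
  by rewrite lerD2l lerN2 ler_wpM2l// mulr_ge0// exprn_ge0// ltW.
rewrite lerBlDr -avgZ -avgD -(avg_cst n0 (3 * K^-1 ^+ 2)); apply: avg_le => // i.
rewrite -subr_ge0; have li := l0 i.
have -> : l i ^+ 2 + 2 * K^-1 ^+ 3 / l i - 3 * K^-1 ^+ 2 =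
   (l i - K^-1) ^+ 2 * (l i + 2 * K^-1) / l i.
  by field; rewrite !gt_eqF.
apply: divr_ge0; last exact: ltW.
apply: mulr_ge0; first exact: sqr_ge0.
by rewrite addr_ge0 ?mulr_ge0 ?(ltW li) ?(ltW iK).
Qed.

Lemma pred_weight_ge : 2 * K^-1 ^+ 4 * (2 * K ^+ 2)^-1 ^+ 3 * d^-1 ^+ 3 <= pred_weight.
Proof.
have /andP[pK _] := phiK; have iK : 0 < K^-1 by rewrite invr_gt0.
have im0 : 0 < (2 * K ^+ 2)^-1 by rewrite invr_gt0; apply: mulr_gt0 => //; exact: exprn_gt0.
have id0 : 0 < d^-1 by rewrite invr_gt0.
rewrite predE.
have h : phi^-1 * (m ^+ 2 * tavg' phi l m) <= phi^-1 * (m ^+ 2 * tavg' phi l m) / (1 - T) ^+ 3.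
  rewrite ler_peMr//; last first.
    by rewrite invf_ge1 ?exprn_gt0// exprn_ile1 ?(ltW T1)// lerBlDr lerDl.
  rewrite m2T'; apply: mulr_ge0; first exact: ltW.
  apply: mulr_ge0; first by rewrite mulr_ge0// ltW.
  by apply: avg_ge0 => // i; rewrite divr_ge0 ?mulr_ge0 ?exprn_ge0 ?addr_ge0 ?(ltW (ml i)) ?(ltW m0) ?(ltW (l0 i)).
apply: le_trans h; rewrite m2T'.
have h2 : (2 * K ^+ 2)^-1 ^+ 3 * d^-1 ^+ 3 * K^-1 ^+ 2 <=
    avg (fun i => m ^+ 3 * l i ^+ 2 / (1 + m * l i) ^+ 3).
  apply: (@le_trans _ _ ((2 * K ^+ 2)^-1 ^+ 3 * d^-1 ^+ 3 * avg (fun i => l i ^+ 2))).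
    by rewrite ler_wpM2l// mulr_ge0// exprn_ge0// ltW.
  rewrite -avgZ; apply: avg_le => // i; have h1 : 0 < 1 + m * l i by rewrite addr_gt0.
  rewrite [X in _ <= X]mulrAC ler_wpM2r ?sqr_ge0//; apply: ler_pM.
  - by rewrite exprn_ge0// ltW.
  - by rewrite exprn_ge0// ltW.
  - by apply: lerXn2r => //; rewrite nnegrE ltW.
  - rewrite -exprVn; apply: lerXn2r; rewrite ?nnegrE ?invr_ge0 ?(ltW d0) ?(ltW h1)//.
    by rewrite lef_pV2 ?posrE.
have -> : 2 * K^-1 ^+ 4 * (2 * K ^+ 2)^-1 ^+ 3 * d^-1 ^+ 3 =
  K^-1 * (2 * K^-1 * ((2 * K ^+ 2)^-1 ^+ 3 * d^-1 ^+ 3 * K^-1 ^+ 2)).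
  by move: (2 * K ^+ 2)^-1 => x; ring.
have q0 : 0 <= (2 * K ^+ 2)^-1 ^+ 3 * d^-1 ^+ 3 * K^-1 ^+ 2.
  by rewrite !mulr_ge0 ?exprn_ge0 ?(ltW im0) ?(ltW id0) ?(ltW iK).
apply: ler_pM => //; rewrite ?(ltW iK)//.
  by rewrite mulr_ge0// mulr_ge0// ltW.
by apply: ler_pM => //; [rewrite mulr_ge0// ltW|rewrite ler_pM2l].
Qed.

Let a0 := K^-1 ^+ 2 * d^-1 ^+ 2 * (2 * K ^+ 2)^-1 ^+ 2.

Let a00 : 0 < a0.
Proof. by rewrite !mulr_gt0 ?exprn_gt0 ?invr_gt0 ?mulr_gt0 ?exprn_gt0. Qed.

Let A2_ge : a0 <= m - s * J2.
Proof.
have /andP[pK _] := phiK; have iK : 0 < K^-1 by rewrite invr_gt0.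
have im0 : 0 < (2 * K ^+ 2)^-1 by rewrite invr_gt0; apply: mulr_gt0 => //; exact: exprn_gt0.
have id0 : 0 < d^-1 by rewrite invr_gt0.
rewrite A2E; apply: ler_pM.
- by rewrite mulr_ge0 ?exprn_ge0 ?(ltW iK) ?(ltW id0).
- by rewrite exprn_ge0// ltW.
- rewrite /P /pavg expr2 -mulrA; apply: ler_pM => //; rewrite ?(ltW iK)//.
    by rewrite mulr_ge0 ?exprn_ge0 ?(ltW iK) ?(ltW id0).
  apply: (@le_trans _ _ (d^-1 ^+ 2 * avg l)).
    by rewrite mulrC ler_wpM2l// exprn_ge0// ltW.
  rewrite -avgZ; apply: avg_le => // i; have h1 : 0 < 1 + m * l i by rewrite addr_gt0.
  rewrite mulrC ler_pM2l// -exprVn; apply: lerXn2r; rewrite ?nnegrE ?invr_ge0 ?(ltW d0) ?(ltW h1)//.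
  by rewrite lef_pV2 ?posrE.
- by apply: le_trans J2m; apply: lerXn2r => //; rewrite nnegrE ltW.
Qed.

Lemma est_weight_ge : 2 * K^-1 * a0 ^+ 2 <= est_weight.
Proof.
have /andP[pK _] := phiK; have iK : 0 < K^-1 by rewrite invr_gt0.
apply: ler_pM.
- by rewrite mulr_ge0// ltW.
- exact: sqr_ge0.
- by rewrite ler_pM2l.
- apply: le_trans A3_ge; apply: lerXn2r => //; rewrite nnegrE ltW//.
Qed.

Lemma in_weight_ge : 2 * (a0 ^+ 2 / M0) <= in_weight.
Proof.
rewrite /in_weight ler_pM2l//; apply: le_trans B3_ge; apply: ler_pM.
- exact: sqr_ge0.
- by rewrite invr_ge0 ltW.
- by apply: lerXn2r => //; rewrite nnegrE ltW.
- by rewrite lef_pV2 ?posrE.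
Qed.

End uniform.
End bounds.

(** * Derivatives of the risks *)

(** The constants of the bounds below with [K (K + 1)] as the bound on [m]. *)
Definition weight_ub (R : realType) (K : R) : R :=
  let M := K * (K + 1) in let d := 1 + K * M in
  2 * K ^+ 2 * M * d ^+ 3 + 2 * K * (M ^+ 2 * d) + 2 * M.

Definition weight_lb (R : realType) (K : R) (k : risk_kind) : R :=
  let M := K * (K + 1) in let d := 1 + K * M in
  let a := K^-1 ^+ 2 * d^-1 ^+ 2 * (2 * K ^+ 2)^-1 ^+ 2 in
  match k with
  | RPred => 2 * K^-1 ^+ 4 * (2 * K ^+ 2)^-1 ^+ 3 * d^-1 ^+ 3
  | REst => 2 * K^-1 * a ^+ 2
  | RIn => 2 * (a ^+ 2 / M)
  end.

Section constants.
Context {R : realType} (K : R).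
Hypothesis K0 : 0 < K.

Let M0 : 0 < K * (K + 1). Proof. by rewrite mulr_gt0// addr_gt0. Qed.

Let d0 : 0 < 1 + K * (K * (K + 1)). Proof. by rewrite addr_gt0// mulr_gt0. Qed.

Lemma weight_lb_gt0 k : 0 < weight_lb K k.
Proof.
have id0 : 0 < (1 + K * (K * (K + 1)))^-1 by rewrite invr_gt0.
have K2 : 0 < (2 * K ^+ 2)^-1.
  by rewrite invr_gt0; apply: mulr_gt0 => //; exact: exprn_gt0.
have iK : 0 < K^-1 by rewrite invr_gt0.
have a0 : 0 < K^-1 ^+ 2 * (1 + K * (K * (K + 1)))^-1 ^+ 2 * (2 * K ^+ 2)^-1 ^+ 2.
  by apply: mulr_gt0; [apply: mulr_gt0|]; exact: exprn_gt0.
case: k => /=.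
- apply: mulr_gt0; last exact: exprn_gt0.
  apply: mulr_gt0; last exact: exprn_gt0.
  by apply: mulr_gt0 => //; exact: exprn_gt0.
- by apply: mulr_gt0; [exact: mulr_gt0|exact: exprn_gt0].
- by apply: mulr_gt0 => //; apply: divr_gt0 => //; exact: exprn_gt0.
Qed.

Lemma weight_ub_gt0 : 0 < weight_ub K.
Proof.
rewrite /weight_ub; apply: addr_gt0; last exact: mulr_gt0.
apply: addr_gt0; apply: mulr_gt0 => //; try exact: exprn_gt0.
- by apply: mulr_gt0 => //; apply: mulr_gt0 => //; exact: exprn_gt0.
- exact: mulr_gt0.
- by apply: mulr_gt0 => //; exact: exprn_gt0.
Qed.

End constants.

Section risk_derivative.
Context {R : realType} (n : nat) (phi : R) (l : 'I_n -> R)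
  (rho : probability (measurableTypeR R) R) (t0 : R).
Hypothesis n0 : (0 < n)%N.
Hypothesis phi0 : 0 < phi.
Hypothesis l0 : forall i, 0 < l i.
Hypothesis eqs : fixed_point_equations phi l rho.
Hypothesis t00 : 0 <= t0.
Hypothesis t01 : phi < 1 -> 0 < t0.
Hypothesis null_left : rho `]-oo, t0[%classic = 0%E.
Implicit Types eta e : R.

Local Notation J k eta := (inv_moment rho t0 k (- eta / phi)).

Definition weight (k : risk_kind) eta : R :=
  match k with
  | RPred => pred_weight phi (J 1 eta) (J 2 eta) (J 3 eta)
  | REst => est_weight phi (eta / phi) (J 2 eta) (J 3 eta)
  | RIn => in_weight (eta / phi) (J 1 eta) (J 2 eta) (J 3 eta)
  end.

(** At [eta = 0] this relies on the gap [0 < t0] between [0] and the support, which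
is present when [phi < 1]. *)
Lemma domain_lt eta : risk_domain phi eta -> - eta / phi < t0.
Proof.
move=> [e0 [e1|/t01 t0gt]].
  by apply: lt_le_trans t00; rewrite mulNr oppr_lt0 divr_gt0.
by apply: le_lt_trans t0gt; rewrite mulNr oppr_le0 divr_ge0// ltW.
Qed.

Section at_point.
Variable eta : R.
Hypothesis dom : risk_domain phi eta.

Let tt0 := domain_lt dom.
Let s0 : 0 <= eta / phi.
Proof. by case: dom => e0 _; rewrite divr_ge0// ltW. Qed.

Let m0 : 0 < J 1 eta. Proof. by have [] := real_equations n0 l0 eqs null_left tt0. Qed.
Let J20 : 0 <= J 2 eta. Proof. exact: inv_moment_ge0. Qed.
Let J30 : 0 <= J 3 eta. Proof. exact: inv_moment_ge0. Qed.

Let eq1 : 1 - tavg phi l (J 1 eta) = (pavg phi l (J 1 eta) + eta / phi) * J 1 eta.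
Proof.
have [_ e _ _] := real_equations n0 l0 eqs null_left tt0.
by rewrite [LHS]e mulNr opprK.
Qed.

Let eq2 : J 1 eta = (pavg phi l (J 1 eta) + eta / phi) * J 2 eta.
Proof.
have [_ _ e _] := real_equations n0 l0 eqs null_left tt0.
by rewrite [LHS]e mulNr opprK.
Qed.

Let eq3 : J 1 eta ^+ 2 = J 2 eta * (1 - tavg phi l (J 1 eta)).
Proof. by have [] := real_equations n0 l0 eqs null_left tt0. Qed.

Let eq4 : 2 * J 3 eta * (1 - tavg phi l (J 1 eta)) =
  J 2 eta ^+ 2 * tavg' phi l (J 1 eta) + 2 * J 1 eta * J 2 eta.
Proof. exact: (third_equation n0 l0 eqs null_left tt0). Qed.

(* [1 - s g = x g] with [g = 1/(x + s)]. *)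
Let sg_le1 x : t0 <= x -> 0 < (x - (- eta / phi))^-1 ->
  eta / phi * (x - (- eta / phi))^-1 <= 1.
Proof.
move=> tx; rewrite mulNr opprK invr_gt0 => x0; rewrite ler_pdivrMr// mul1r.
by rewrite lerDr (le_trans t00).
Qed.

(* Integral of [x g (g - c)^2 >= 0]. *)
Let cs_est c : 2 * c * (J 1 eta - eta / phi * J 2 eta) -
  c ^+ 2 * (1 - eta / phi * J 1 eta) <= J 2 eta - eta / phi * J 3 eta.
Proof.
rewrite -subr_ge0.
have := @inv_moment_poly _ rho t0 null_left (- eta / phi) (c ^+ 2)
  (- c ^+ 2 * (eta / phi) - 2 * c) (1 + 2 * c * (eta / phi)) (- (eta / phi)) tt0.
have E : forall A B : R, A = B -> 0 <= A -> 0 <= B by move=> A B ->.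
move=> h; apply: E (h _); first by ring.
move=> x tx /= g0; have := sg_le1 tx g0; move: (_^-1) (eta / phi) g0 => g s g0 sg.
have -> : c ^+ 2 + (- c ^+ 2 * s - 2 * c) * g + (1 + 2 * c * s) * g ^+ 2 + - s * g ^+ 3
  = (1 - s * g) * (g - c) ^+ 2 by ring.
by rewrite mulr_ge0 ?sqr_ge0 ?subr_ge0.
Qed.

(* Integral of [g (x g - c)^2 >= 0]. *)
Let cs_in c : 2 * c * (J 1 eta - eta / phi * J 2 eta) - c ^+ 2 * J 1 eta <=
  J 1 eta - 2 * (eta / phi) * J 2 eta + (eta / phi) ^+ 2 * J 3 eta.
Proof.
rewrite -subr_ge0.
have := @inv_moment_poly _ rho t0 null_left (- eta / phi) 0
  (1 - 2 * c + c ^+ 2) (- 2 * (eta / phi) + 2 * c * (eta / phi)) ((eta / phi) ^+ 2) tt0.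
have E : forall A B : R, A = B -> 0 <= A -> 0 <= B by move=> A B ->.
move=> h; apply: E (h _); first by ring.
move=> x tx /= g0; move: (_^-1) (eta / phi) g0 => g s g0.
have -> : 0 + (1 - 2 * c + c ^+ 2) * g + (- 2 * s + 2 * c * s) * g ^+ 2 + s ^+ 2 * g ^+ 3
  = g * (1 - s * g - c) ^+ 2 by ring.
by rewrite mulr_ge0 ?sqr_ge0 ?ltW.
Qed.

(* Integral of [(x g)^2 g <= g]. *)
Let in_le : J 1 eta - 2 * (eta / phi) * J 2 eta + (eta / phi) ^+ 2 * J 3 eta <= J 1 eta.
Proof.
rewrite -subr_ge0.
have := @inv_moment_poly _ rho t0 null_left (- eta / phi) 0 0
  (2 * (eta / phi)) (- (eta / phi) ^+ 2) tt0.
have E : forall A B : R, A = B -> 0 <= A -> 0 <= B by move=> A B ->.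
move=> h; apply: E (h _); first by ring.
move=> x tx /= g0; have := sg_le1 tx g0; move: (_^-1) (eta / phi) s0 g0 => g s s00 g0 sg.
have -> : 0 + 0 * g + 2 * s * g ^+ 2 + - s ^+ 2 * g ^+ 3 = s * g ^+ 2 * (2 - s * g) by ring.
by rewrite !mulr_ge0 ?exprn_ge0 ?(ltW g0)//; lra.
Qed.

Lemma weight_gt0 k : 0 < weight k eta.
Proof.
case: k => /=.
- exact: (pred_weight_gt0 n0 phi0 l0 s0 m0 eq1 eq3 eq4).
- exact: (est_weight_gt0 n0 phi0 l0 s0 m0 J20 eq2 eq3 cs_est).
- exact: (in_weight_gt0 n0 phi0 l0 m0 J20 eq2 eq3 cs_in).
Qed.

Section at_point_uniform.
Variable K : R.
Hypothesis K0 : 0 < K.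
Hypothesis lK : forall i, l i <= K.
Hypothesis ilK : avg (fun i => (l i)^-1) <= K.
Hypothesis phiK : K^-1 <= phi^-1 <= K.
Hypothesis lo : Xi_lo phi K <= eta.

Let mM0 : J 1 eta <= K * (K + 1).
Proof.
have /andP[p1 _] := phiK.
move: lo; rewrite /Xi_lo; case: ltP => [_|h] e1.
  apply: (stieltjes_le_far n0 phi0 l0 m0 eq1 K0); rewrite -exprVn expr2.
  by apply: ler_pM => //; rewrite invr_ge0 ltW.
exact: (stieltjes_le_overparam n0 phi0 l0 s0 m0 eq1 K0 ilK h).
Qed.

Lemma weight_le k : weight k eta <= weight_ub K.
Proof.
rewrite /weight_ub.
have M0 : 0 < K * (K + 1) by rewrite mulr_gt0// addr_gt0.
have d0 : 0 < 1 + K * (K * (K + 1)) by rewrite addr_gt0// mulr_gt0.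
have h1 := pred_weight_le n0 phi0 l0 s0 m0 eq1 eq3 eq4 K0 lK phiK mM0.
have h2 := est_weight_le n0 phi0 l0 s0 m0 J30 eq1 eq3 cs_est K0 lK phiK mM0.
have h3 := in_weight_le in_le mM0.
have g1 := pred_weight_gt0 n0 phi0 l0 s0 m0 eq1 eq3 eq4.
have g2 := est_weight_gt0 n0 phi0 l0 s0 m0 J20 eq2 eq3 cs_est.
have g3 := in_weight_gt0 n0 phi0 l0 m0 J20 eq2 eq3 cs_in.
have p1 : 0 < 2 * K ^+ 2 * (K * (K + 1)) * (1 + K * (K * (K + 1))) ^+ 3.
  exact: lt_le_trans g1 h1.
have p2 : 0 < 2 * K * ((K * (K + 1)) ^+ 2 * (1 + K * (K * (K + 1)))).
  exact: lt_le_trans g2 h2.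
by case: k => /=; move: p1 p2 h1 h2 h3; lra.
Qed.

Hypothesis hi : eta <= K.

Lemma weight_ge k : weight_lb K k <= weight k eta.
Proof.
have /andP[_ p1] := phiK.
have sK : eta / phi <= K ^+ 2.
  by case: dom => e0 _; rewrite expr2 ler_pM// invr_ge0 ltW.
case: k => /=.
- exact: (pred_weight_ge n0 phi0 l0 s0 m0 eq1 eq3 eq4 K0 lK ilK phiK mM0 sK).
- exact: (est_weight_ge n0 phi0 l0 s0 m0 J20 eq1 eq2 eq3 cs_est K0 lK ilK phiK mM0 sK).
- exact: (in_weight_ge n0 phi0 l0 m0 J20 eq1 eq2 eq3 cs_in K0 lK ilK phiK mM0 sK).
Qed.

End at_point_uniform.
End at_point.

Lemma is_derive_moment_eta k eta : - eta / phi < t0 ->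
  is_derive eta (1 : R) (fun e => J k.+1 e) (- (k.+1%:R * J k.+2 eta) / phi).
Proof.
move=> tt0.
have dg : is_derive eta (1 : R) (fun e => - e / phi) (- 1 / phi).
  have := is_deriveR_M (is_deriveN (is_derive_id eta (1 : R))) (is_derive_cst phi^-1 eta (1 : R)).
  by move/is_derive_eq; apply; rewrite mulr0 addr0.
have dJ := is_derive_inv_moment rho k tt0.
have := @is_derive1_comp _ _ (fun e : R => - e / phi) eta _ _ dJ dg.
by move/is_derive_eq; apply; ring.
Qed.

Lemma m_etaE eta : - eta / phi < t0 -> m_eta rho phi eta = J 1 eta.
Proof. by move=> tt0; exact: stieltjes_inv_moment. Qed.

(** [m_eta'] is defined through [derive1], which has the expected value because
[stieltjes] agrees with [J 1] on a whole neighbourhood. *)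
Lemma m_eta'E eta : - eta / phi < t0 -> m_eta' rho phi eta = J 2 eta.
Proof.
move=> tt0; rewrite /m_eta' derive1E.
have dJ := is_derive_inv_moment rho 0 tt0; rewrite mul1r in dJ.
have dS : is_derive (- eta / phi) (1 : R) (stieltjes rho) (J 2 eta).
  apply: near_eq_is_derive dJ.
  have lt0 : \forall x \near - eta / phi, x < t0 by exact: lt_nbhsl.
  by apply: filterS lt0 => x xt; rewrite (stieltjes_inv_moment null_left).
exact: (@derive_val _ _ _ _ _ _ _ dS).
Qed.

Lemma near_domain eta : - eta / phi < t0 -> \forall e \near eta, - e / phi < t0.
Proof.
move=> tt0; have h : - (t0 * phi) < eta.
  by rewrite ltrNl -ltr_pdivrMr// .
have := lt_nbhsr h; apply: filterS => x; rewrite ltrNl => hx.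
by rewrite ltr_pdivrMr.
Qed.

(** The factor [eta |mu0|^2 - sigma2] comes out of each derivative because the
terms free of it cancel. *)
Lemma is_derive_risk (mu0 : 'cV[R]_n) (sigma2 : R) k eta : - eta / phi < t0 ->
  is_derive eta (1 : R) (risk rho phi mu0 sigma2 k)
    (weight k eta * (eta * enorm mu0 ^+ 2 - sigma2)).
Proof.
move=> tt0; have [m0 _ _ _] := real_equations n0 l0 eqs null_left tt0.
set b := enorm mu0 ^+ 2.
have d1 := is_derive_moment_eta 0 tt0; rewrite mul1r in d1.
have d2 := is_derive_moment_eta 1 tt0.
have dc (c : R) := is_derive_cst c eta (1 : R).
have did : is_derive eta (1 : R) (fun e : R => e) 1 := is_derive_id eta (1 : R).
have dlin : is_derive eta (1 : R) (fun e : R => e * b - sigma2) b.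
  have := is_deriveR_B (is_deriveR_M did (dc b)) (dc sigma2).
  by move/is_derive_eq; apply; rewrite /cst; ring.
have dcore : is_derive eta (1 : R)
    (fun e => phi * b * J 1 e - (e * b - sigma2) * J 2 e)
    (- 2 * b * J 2 eta + (eta * b - sigma2) * (2 * J 3 eta) / phi).
  have := is_deriveR_B (is_deriveR_M (dc (phi * b)) d1) (is_deriveR_M dlin d2).
  by move/is_derive_eq; apply; rewrite /cst; field; rewrite gt_eqF.
have near_eta := near_domain tt0.
case: k => /=.
- have dm2 := is_deriveR_X 2 d1.
  have m2 : J 1 eta ^+ 2 != 0 by rewrite expf_neq0// gt_eqF.
  have dv := @is_deriveR_V _ (fun e => J 1 e ^+ 2) eta _ m2 dm2.
  have dR := is_deriveR_B (is_deriveR_M dv dcore) (dc sigma2).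
  apply: (@near_eq_is_derive _ _ _ (fun e => (J 1 e ^+ 2)^-1 *
    (phi * b * J 1 e - (e * b - sigma2) * J 2 e) - sigma2)).
    by apply: filterS near_eta => e he; rewrite /risk m_etaE// m_eta'E.
  move/is_derive_eq : dR; apply; rewrite /pred_weight /cst /= expr1; field.
  by rewrite !gt_eqF.
- have dR := is_deriveR_D (is_deriveR_D (dc (b * (1 - phi))) (is_deriveR_M (dc sigma2) d1))
    (is_deriveR_M (is_deriveR_M (is_deriveR_M did (dc phi^-1)) dlin) d2).
  apply: (@near_eq_is_derive _ _ _ (fun e => b * (1 - phi) + sigma2 * J 1 e +
    e / phi * (e * b - sigma2) * J 2 e)).
    by apply: filterS near_eta => e he; rewrite /risk m_etaE// m_eta'E.
  move/is_derive_eq : dR; apply; rewrite /est_weight /cst /=; field.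
  by rewrite !gt_eqF.
- have dR := is_deriveR_D
    (is_deriveR_M (is_deriveR_M (is_deriveR_X 2 did) (dc phi^-1)) dcore)
    (is_deriveR_M (dc sigma2) (is_deriveR_B (dc phi)
      (is_deriveR_M (is_deriveR_M (dc 2) did) d1))).
  apply: (@near_eq_is_derive _ _ _ (fun e => e ^+ 2 / phi *
    (phi * b * J 1 e - (e * b - sigma2) * J 2 e) + sigma2 * (phi - 2 * e * J 1 e))).
    by apply: filterS near_eta => e he; rewrite /risk m_etaE// m_eta'E.
  move/is_derive_eq : dR; apply; rewrite /in_weight /cst /= expr1; field.
  by rewrite !gt_eqF.
Qed.

Lemma weight_continuous k eta : - eta / phi < t0 -> {for eta, continuous (weight k)}.
Proof.
move=> tt0; have [m0 _ _ _] := real_equations n0 l0 eqs null_left tt0.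
have cJ j : {for eta, continuous (fun e => J j.+1 e)}.
  apply: differentiable_continuous; apply/derivable1_diffP.
  by have [] := is_derive_moment_eta j tt0.
have cs : {for eta, continuous (fun e => e / phi)}.
  by apply: cvgM; [exact: cvg_id|exact: cvg_cst].
case: k => /=.
- apply: cvgM.
    apply: cvgB; first by apply: cvgM; [apply: cvgM; [exact: cvg_cst|exact: (cJ 0%N)]|exact: (cJ 2%N)].
    by apply: cvgM; [exact: cvg_cst|apply: cvgM; exact: (cJ 1%N)].
  apply: cvgV; first by rewrite mulf_neq0 ?expf_neq0 ?gt_eqF.
  by apply: cvgM; [exact: cvg_cst|apply: cvgM; [exact: (cJ 0%N)|apply: cvgM; exact: (cJ 0%N)]].
- apply: cvgM; first exact: cvg_cst.
  by apply: cvgB; [exact: (cJ 1%N)|apply: cvgM => //; exact: (cJ 2%N)].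
- apply: cvgM; first exact: cvg_cst.
  apply: cvgD.
    apply: cvgB; first exact: (cJ 0%N).
    apply: cvgM; last exact: (cJ 1%N).
    by apply: cvgM => //; exact: cvg_cst.
  by apply: cvgM; [apply: cvgM|exact: (cJ 2%N)].
Qed.

End risk_derivative.

(** * Quadratic growth around the minimiser *)

(** Exact second-order remainder around the minimiser: Rolle's theorem for
[f - a (x - e0)^2], with [a] chosen so that the values at [e] and [e0] agree. *)
Lemma quadratic_gap (R : realType) (f w : R -> R) (b e0 e : R) :
  (forall x, Num.min e e0 <= x <= Num.max e e0 ->
     is_derive x (1 : R) f (w x * (b * (x - e0)))) ->
  e != e0 ->
  exists2 c, Num.min e e0 <= c <= Num.max e e0 &
    f e - f e0 = b / 2 * w c * (e - e0) ^+ 2.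
Proof.
set p := Num.min e e0; set q := Num.max e e0 => df ne.
have ee0 : e - e0 != 0 by rewrite subr_eq0.
pose a := (f e - f e0) / (e - e0) ^+ 2.
pose g x := f x - a * (x - e0) ^+ 2.
have ge : g e = f e0 by rewrite /g /a divfK ?expf_neq0// subKr.
have ge0 : g e0 = f e0 by rewrite /g subrr expr0n /= mulr0 subr0.
have [pq gpq e0pq] : [/\ p < q, g q = g p & e0 \notin `]p, q[].
  rewrite /p /q; case: (ltgtP e e0) => [h|h|/eqP]; last by rewrite (negbTE ne).
    by split; rewrite ?ge ?ge0// in_itv /= ltxx andbF.
  by split; rewrite ?ge ?ge0// in_itv /= ltxx.
have dg x : p <= x <= q ->
    is_derive x (1 : R) g ((b * w x - 2 * a) * (x - e0)).
  move=> /df dfx.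
  have dl : is_derive x (1 : R) (fun z : R => z - e0) (1 - 0).
    exact: is_deriveR_B (is_derive_id x (1 : R)) (is_derive_cst e0 x (1 : R)).
  have := is_deriveR_B dfx (is_deriveR_M (is_derive_cst a x (1 : R)) (is_deriveR_X 2 dl)).
  by move/is_derive_eq; apply; rewrite /cst /= expr1; ring.
have cg : {within `[p, q], continuous g}.
  apply: derivable_within_continuous => x; rewrite in_itv /= => /dg hx.
  exact: (@ex_derive _ _ _ _ _ _ _ hx).
have dgo x : x \in `]p, q[ ->
    is_derive x (1 : R) g ((b * w x - 2 * a) * (x - e0)).
  by move=> /subset_itv_oo_cc; rewrite in_itv /=; exact: dg.
have [c cpq] := MVT pq dgo cg.
rewrite gpq subrr => /esym/eqP; rewrite !mulf_eq0.
have /negbTE -> : q - p != 0 by rewrite subr_eq0 gt_eqF.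
have /negbTE -> : c - e0 != 0.
  by rewrite subr_eq0; apply: contraNneq e0pq => <-.
rewrite !orbF subr_eq0 => /eqP bw.
exists c; first by have := subset_itv_oo_cc cpq; rewrite in_itv.
have -> : b / 2 * w c = a by rewrite mulrAC bw; field.
by rewrite /a divfK// expf_neq0.
Qed.

Theorem proposition3p4 (R : realType) (K : R) (hK : 0 < K) :
  exists C : R, 0 < C /\
  forall (m n : nat) (Sigma : 'M[R]_n) (mu0 : 'cV[R]_n) (sigma2 : R)
         (rho : probability (measurableTypeR R) R),
  let phi := aspect R m n in
  (0 < m)%N -> (0 < n)%N ->
  covariance_mx Sigma -> Sigma \in unitmx -> 0 <= sigma2 ->
  asymptotic_eigenvalue_density phi Sigma rho ->
  K^-1 <= phi^-1 <= K ->
  Num.max (opnorm Sigma) (trinv Sigma) <= K ->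
  (exists M : risk_kind -> R -> R,
     forall k : risk_kind,
       [/\ measurable_fun (`[0, +oo[ : set (measurableTypeR R)) (M k),
           forall eta : R, 0 <= eta -> 0 < M k eta,
           forall eta : R, Xi_lo phi K <= eta -> M k eta <= C,
           forall eta : R, Xi phi K eta -> C^-1 <= M k eta &
           forall eta : R, risk_domain phi eta ->
             is_derive eta (1 : R) (risk rho phi mu0 sigma2 k)
               (M k eta * (eta * enorm mu0 ^+ 2 - sigma2))]) /\
  (mu0 != 0 ->
   let etastar := (snr mu0 sigma2)^-1 in
   Xi phi K etastar ->
   forall k : risk_kind,
     let Rk := risk rho phi mu0 sigma2 k in
     let Q := fun eta : R => `|Rk eta - Rk etastar| /
                             (enorm mu0 ^+ 2 * (eta - etastar) ^+ 2) in
     [/\ forall eta : R, risk_domain phi eta -> Rk etastar <= Rk eta,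
         forall eta : R, Xi_lo phi K <= eta -> eta != etastar -> Q eta <= C &
         forall eta : R, Xi phi K eta -> eta != etastar -> C^-1 <= Q eta]).
Proof.
have lb0 k := weight_lb_gt0 hK k.
have ub0 := weight_ub_gt0 hK.
(* The factor 2 absorbs the 1/2 of [quadratic_gap]. *)
pose lbi k := 2 / weight_lb K k.
have lbi0 k : 0 < lbi k by rewrite divr_gt0.
pose C := weight_ub K + lbi RPred + lbi REst + lbi RIn.
have C0 : 0 < C by do 3 (apply: addr_gt0 => //).
have CU : weight_ub K <= C.
  by have := lbi0 RPred; have := lbi0 REst; have := lbi0 RIn; rewrite /C; lra.
have CL k : C^-1 <= weight_lb K k / 2.
  rewrite -[leRHS]invrK lef_pV2 ?posrE// ?invr_gt0 ?divr_gt0// invf_div -/(lbi k).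
  have := lbi0 RPred; have := lbi0 REst; have := lbi0 RIn.
  by rewrite /C; case: k; lra.
exists C; split=> // m n Sigma mu0 sigma2 rho phi hm n0 cov unitS sig0 dens phiK.
rewrite ge_max => /andP[opK trK].
have phi0 : 0 < phi by rewrite /phi /aspect divr_gt0 ?ltr0n.
have [l [l0 lop trE trC]] := covariance_spectrum cov unitS.
have lK i : l i <= K := le_trans (lop i) opK.
have ilK : avg (fun i => (l i)^-1) <= K by move: trK; rewrite /trinv trE.
have eqs := density_equations l0 trC dens.
have [t0 [t00 t01 null_left]] : exists t0 : R, [/\ 0 <= t0, phi < 1 -> 0 < t0 &
    rho `]-oo, t0[%classic = 0%E].
  have [phi1|phi1] := ltP phi 1.
    have [t0 t00 nt0] := support_gt0 n0 phi0 l0 eqs phi1.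
    by exists t0; split => //; exact: ltW.
  by exists 0; split => //; exact: (support_ge0 n0 phi0 l0 eqs).
have dom_lo eta : Xi_lo phi K <= eta -> risk_domain phi eta.
  rewrite /Xi_lo; case: ltP => [_|h] e0.
    have e1 : 0 < eta by apply: lt_le_trans e0; rewrite invr_gt0.
    by split; [exact: ltW|left].
  split => //; right.
  have : 1 < phi^-1 by apply: lt_le_trans h; rewrite ltrDl invr_gt0.
  by rewrite invf_gt1.
have XiP eta : Xi phi K eta -> Xi_lo phi K <= eta /\ eta <= K.
  by rewrite /Xi /= in_itv /= => /andP.
pose w := weight phi rho t0.
have w0 k eta : risk_domain phi eta -> 0 < w k eta.
  by move=> h; exact: (weight_gt0 n0 phi0 l0 eqs t00 t01 null_left h).
have wC k eta : Xi_lo phi K <= eta -> w k eta <= weight_ub K.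
  move=> h; exact: (weight_le n0 phi0 l0 eqs t00 t01 null_left (dom_lo _ h) hK lK ilK phiK h).
have wL k eta : Xi phi K eta -> weight_lb K k <= w k eta.
  move=> /XiP[h1 h2].
  exact: (weight_ge n0 phi0 l0 eqs t00 t01 null_left (dom_lo _ h1) hK lK ilK phiK h1 h2).
have dR k eta : risk_domain phi eta -> is_derive eta (1 : R) (risk rho phi mu0 sigma2 k)
    (w k eta * (eta * enorm mu0 ^+ 2 - sigma2)).
  move=> h; apply: (is_derive_risk n0 phi0 l0 eqs null_left).
  exact: (domain_lt phi0 t00 t01 h).
split.
- (* For [phi >= 1] the point [eta = 0] is outside the domain of the risks; any
     positive value will do there. *)
  pose M k (eta : R) := if (0 < eta) || (phi < 1) then w k eta else 1.
  have Mw k eta : risk_domain phi eta -> M k eta = w k eta.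
    by move=> [_ h]; rewrite /M; case: h => ->; rewrite ?orbT.
  exists M => k; split.
  + have -> : `[0, +oo[%classic = [set (0 : R)] `|` `]0, +oo[%classic.
      by rewrite (@setU1itv _ _ _ _ false).
    apply/measurable_funU => //; split; first exact: measurable_fun_set1.
    apply: (eq_measurable_fun (w k)).
      move=> x /set_mem; rewrite /= in_itv /= andbT => x0; rewrite Mw//.
      by split; [exact: ltW|left].
    apply: open_continuous_measurable_fun; first exact: interval_open.
    move=> x /set_mem; rewrite /= in_itv /= andbT => x0.
    apply: (weight_continuous n0 phi0 l0 eqs null_left).
    by apply: (domain_lt phi0 t00 t01); split; [exact: ltW|left].
  + move=> eta e0; rewrite /M; case: ifPn => [/orP h|_]; last exact: ltr01.
    by apply: w0; split.
  + by move=> eta h; rewrite Mw; [exact: le_trans (wC k eta h) CU|exact: dom_lo].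
  + move=> eta h; have [h1 _] := XiP _ h; rewrite Mw; last exact: dom_lo.
    apply: le_trans (CL k) _; apply: le_trans _ (wL k eta h).
    by rewrite ler_pdivrMr// ler_peMr ?ler1n// ltW.
  + by move=> eta h; rewrite Mw//; exact: dR.
- move=> mu00 es hes k Rk Q.
  have b0 : 0 < enorm mu0 ^+ 2 by rewrite exprn_gt0// enorm_gt0.
  have [es1 es2] := XiP _ hes; have esd := dom_lo _ es1.
  have sE : sigma2 = enorm mu0 ^+ 2 * es.
    by rewrite /es /snr invf_div mulrCA divff ?mulr1// gt_eqF.
  have dom_gap eta c : risk_domain phi eta -> Num.min eta es <= c -> risk_domain phi c.
    move=> [ed0 ed1] x1; case: esd => esd0 esd1; split.
      by apply: le_trans x1; rewrite le_min ed0.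
    case: ed1 => [ed1|]; last by right.
    case: esd1 => [esd1|]; last by right.
    by left; apply: lt_le_trans x1; rewrite lt_min ed1.
  have gap eta : risk_domain phi eta -> eta != es ->
    exists2 c, Num.min eta es <= c <= Num.max eta es &
      Rk eta - Rk es = enorm mu0 ^+ 2 / 2 * w k c * (eta - es) ^+ 2.
    move=> ed; apply: quadratic_gap => x /andP[x1 _].
    have dx : risk_domain phi x := dom_gap eta x ed x1.
    move: (dR k x dx) => /is_derive_eq; apply.
    by rewrite {1}sE; ring.
  have Qc eta c : eta != es -> 0 < w k c ->
      Rk eta - Rk es = enorm mu0 ^+ 2 / 2 * w k c * (eta - es) ^+ 2 ->
      Q eta = w k c / 2.
    move=> ne wc0 E; rewrite /Q E ger0_norm.
      by field; rewrite subr_eq0 ne gt_eqF// enorm_gt0.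
    by apply: mulr_ge0; [apply: mulr_ge0; [apply: divr_ge0|]; exact: ltW|exact: sqr_ge0].
  split=> eta.
  + move=> ed; have [->//|ne] := eqVneq eta es.
    have [c /andP[c1 _] E] := gap eta ed ne.
    rewrite -subr_ge0 E; apply: mulr_ge0; last exact: sqr_ge0.
    apply: mulr_ge0; first by rewrite divr_ge0// ltW.
    exact/ltW/w0/(dom_gap eta).
  + move=> ed ne; have [c /andP[c1 c2] E] := gap eta (dom_lo _ ed) ne.
    have wc0 := w0 k c (dom_gap eta c (dom_lo _ ed) c1).
    rewrite (Qc eta c ne wc0 E).
    have wcC : w k c <= weight_ub K by apply: wC; apply: le_trans c1; rewrite le_min ed.
    by lra.
  + move=> ed ne; have [ed1 ed2] := XiP _ ed.
    have [c /andP[c1 c2] E] := gap eta (dom_lo _ ed1) ne.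
    have wc0 := w0 k c (dom_gap eta c (dom_lo _ ed1) c1).
    rewrite (Qc eta c ne wc0 E); apply: le_trans (CL k) _.
    rewrite ler_pM2r//; apply: wL; rewrite /Xi /= in_itv /=; apply/andP; split.
      by apply: le_trans c1; rewrite le_min ed1.
    by apply: le_trans c2 _; rewrite ge_max ed2.
Qed.
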